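(* For $n\ge0$ define the linear functional $\zeta$ on $\mathsf{scf}(\mathrm{UT}_\bullet)=\bigoplus_{n\ge0}\mathsf{scf}(\mathrm{UT}_n)$ by $\zeta(\phi)=(q-1)^n\,\langle \phi,\delta_{([n],\emptyset)}\rangle/\langle \delta_{([n],\emptyset)},\delta_{([n],\emptyset)}\rangle$ for $\phi\in\mathsf{scf}(\mathrm{UT}_n)$, and the linear functional $\varepsilon$ on $\mathsf{cf}(\mathrm{GL}_\bullet)=\bigoplus_{n\ge 0}\mathsf{cf}(\mathrm{GL}_n)$ by $\varepsilon(\psi)=\langle\psi,\delta_{(n)}\rangle/\langle\delta_{(n)},\delta_{(n)}\rangle$ (i.e. the value of $\psi$ at a regular unipotent element) for $\psi\in\mathsf{cf}(\mathrm{GL}_n)$. Then $\zeta$ is a linear character of the Hopf algebra $\mathsf{scf}(\mathrm{UT}_\bullet)$, $\zeta=\varepsilon\circ\operatorname{Ind}^{\mathrm{GL}}_{\mathrm{UT}}$, and consequently $\operatorname{Ind}^{\mathrm{GL}}_{\mathrm{UT}}$ is a CHA morphism $(\mathsf{scf}(\mathrm{UT}_\bullet),\zeta)\to(\mathsf{cf}(\mathrm{GL}_\bullet),\varepsilon)$.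
   Context: $q$ is a prime power, $\mathrm{GL}_n=\mathrm{GL}_n(\mathbb{F}_q)$, $\mathrm{UT}_n$ its unipotent upper triangular subgroup. Indifference graphs on $[n]$: simple graphs on $[n]$ such that $\{i,l\}\in E(\gamma)$ implies $\{j,k\}\in E(\gamma)$ for all $i\le j<k\le l$. $\mathrm{UT}_\gamma=\{g\in\mathrm{UT}_n: g_{i,j}=0 \text{ for } i<j,\{i,j\}\in E(\gamma)\}$. For an indifference graph $\gamma$, $\mathrm{UT}^\circ_\gamma$ is the set of $g\in \mathrm{UT}_\gamma$ not lying in $\mathrm{UT}_\tau$ for any indifference graph $\tau$ on $[n]$ with $E(\tau)\supsetneq E(\gamma)$; these sets partition $\mathrm{UT}_n$. $\mathsf{scf}(\mathrm{UT}_n)$ is the space of functions $\mathrm{UT}_n\to\mathbb{C}$ constant on each $\mathrm{UT}^\circ_\gamma$; $\delta_\gamma$ is the indicator of $\mathrm{UT}^\circ_\gamma$. In particular $\mathrm{UT}^\circ_{([n],\emptyset)}=\{g\in\mathrm{UT}_n: g_{i,i+1}\neq0 \text{ for } 1\le i<n\}$. $\langle\phi,\psi\rangle=\frac1{|G|}\sum_{g\in G}\phi(g)\overline{\psi(g)}$. $\delta_{(n)}$ is the indicator function of the conjugacy class of regular unipotent elements of $\mathrm{GL}_n$ (the class of a single $n\times n$ Jordan block with eigenvalue $1$). $\mathsf{cf}(\mathrm{GL}_\bullet)$ carries Zelevinsky's graded connected Hopf algebra structure: the product of $\psi\in\mathsf{cf}(\mathrm{GL}_a)$, $\phi\in\mathsf{cf}(\mathrm{GL}_b)$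 is the induction to $\mathrm{GL}_{a+b}$ from the block upper triangular parabolic subgroup $P_{a,b}$ of the inflation of $\psi\times\phi$ from its Levi quotient $\mathrm{GL}_a\times\mathrm{GL}_b$, and the coproduct is given by the dual (Harish-Chandra) restriction; $\varepsilon$ is a linear character of it. $\mathsf{scf}(\mathrm{UT}_\bullet)$ carries the graded connected Hopf algebra structure (from the author's earlier work) for which $\operatorname{Ind}^{\mathrm{GL}}_{\mathrm{UT}}=\bigoplus_n\operatorname{Ind}^{\mathrm{GL}_n}_{\mathrm{UT}_n}$ is a Hopf algebra homomorphism into $\mathsf{cf}(\mathrm{GL}_\bullet)$. A linear character of a Hopf algebra $H$ is an algebra homomorphism $H\to\mathbb{C}$; a combinatorial Hopf algebra (CHA) is a pair $(H,\zeta)$ of a graded connected Hopf algebra and a linear character; a CHA morphism $(H,\zeta)\to(H',\zeta')$ is a graded Hopf algebra homomorphism $\Psi$ with $\zeta=\zeta'\circ\Psi$. *)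

(* Defs.v *)
From HB Require Import structures.
From mathcomp Require Import all_boot all_order all_algebra all_fingroup.

Set Implicit Arguments.
Unset Strict Implicit.
Unset Printing Implicit Defensive.

Import GRing.Theory Num.Theory.
Local Open Scope ring_scope.

(* MathComp. A function on a subset G of 'M[F]_n (such as GL_n or UT_n) is a
   function on 'M[F]_n vanishing outside G, as for 'CF(G) in classfun.v.  The
   groups {'GL_n[F]} are not used because {'GL_0[F]} is GL_1, whereas degree 0
   of the graded spaces below needs the trivial group, i.e. 'M[F]_0. *)

Section Groups.
Variable F : finFieldType.

Definition GL n : {set 'M[F]_n} := [set g : 'M[F]_n | g \in unitmx].

Definition UT n : {set 'M[F]_n} :=
  [set g : 'M[F]_n | [forall i, g i i == 1] &&
                     [forall i : 'I_n, forall j : 'I_n, (j < i)%N ==> (g i j == 0)]].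

Definition parabolic a b : {set 'M[F]_(a + b)} :=
  [set g : 'M[F]_(a + b) | (g \in unitmx) && (dlsubmx g == 0)].

Definition jordan_block n : 'M[F]_n :=
  \matrix_(i, j) ((i == j) || (i.+1 == j :> nat))%:R.

Definition regular_unipotent n : {set 'M[F]_n} :=
  [set x *m jordan_block n *m invmx x | x in GL n].

(* A simple graph on {0, ..., n-1} is given by its set of ordered adjacent
   pairs, so that proper inclusion of such sets is proper inclusion of edge
   sets. *)
Definition indifference n (E : {set 'I_n * 'I_n}) : bool :=
  [&& [forall i, (i, i) \notin E],
      [forall i, forall j, ((i, j) \in E) ==> ((j, i) \in E)]
    & [forall i : 'I_n, forall j : 'I_n, forall k : 'I_n, forall l : 'I_n,
        [&& (i <= j)%N, (j < k)%N, (k <= l)%N & (i, l) \in E]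
          ==> ((j, k) \in E)]].

Definition UTgraph n (E : {set 'I_n * 'I_n}) : {set 'M[F]_n} :=
  [set g in UT n | [forall i : 'I_n, forall j : 'I_n,
                     ((i < j)%N && ((i, j) \in E)) ==> (g i j == 0)]].

Definition UTo n (E : {set 'I_n * 'I_n}) : {set 'M[F]_n} :=
  [set g in UTgraph E |
    ~~ [exists T : {set 'I_n * 'I_n},
          [&& indifference T, E \proper T & g \in UTgraph T]]].

(* w places the first a and the last b indices as increasing subsequences of
   {0, ..., a+b-1}; these w enumerate the decompositions of {0, ..., a+b-1}
   into a set I of size a (the image of the first a indices) and its
   complement J. *)
Definition shuffle a b (w : 'S_(a + b)) : bool :=
  [forall i : 'I_a, forall j : 'I_a,
     (i < j)%N ==> (w (lshift b i) < w (lshift b j))%N] &&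
  [forall i : 'I_b, forall j : 'I_b,
     (i < j)%N ==> (w (rshift a i) < w (rshift a j))%N].

(* The I x I, I x J, J x J and J x I blocks are g, u, h and 0. *)
Definition shuffle_mx a b (w : 'S_(a + b)) (g : 'M[F]_a) (u : 'M[F]_(a, b))
    (h : 'M[F]_b) : 'M[F]_(a + b) :=
  \matrix_(i, j) block_mx g u 0 h ((w^-1)%g i) ((w^-1)%g j).

Definition shuffle_radical a b (w : 'S_(a + b)) : {set 'M[F]_(a, b)} :=
  [set u | shuffle_mx w 1%:M u 1%:M \in UT (a + b)].

End Groups.

Section Functions.
Variables (F : finFieldType) (C : numClosedFieldType).

Definition indic n (A : {set 'M[F]_n}) : {ffun 'M[F]_n -> C} :=
  [ffun g => (g \in A)%:R].

Definition inner n (G : {set 'M[F]_n}) (phi psi : {ffun 'M[F]_n -> C}) : C :=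
  #|G|%:R^-1 * \sum_(g in G) phi g * (psi g)^*.

Definition induce n (H G : {set 'M[F]_n}) (phi : {ffun 'M[F]_n -> C}) :
    {ffun 'M[F]_n -> C} :=
  [ffun g => #|H|%:R^-1 * \sum_(x in G | x *m g *m invmx x \in H)
                             phi (x *m g *m invmx x)].

(* Inflation to a group H of block upper triangular matrices from its group
   of block diagonal matrices. *)
Definition inflate a b (H : {set 'M[F]_(a + b)})
    (phi : {ffun 'M[F]_a -> C}) (psi : {ffun 'M[F]_b -> C}) :
    {ffun 'M[F]_(a + b) -> C} :=
  [ffun g => if g \in H then phi (ulsubmx g) * psi (drsubmx g) else 0].

Definition cfGL n (psi : {ffun 'M[F]_n -> C}) : Prop :=
  (forall g, g \notin GL F n -> psi g = 0) /\
  (forall x g, x \in GL F n -> g \in GL F n ->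
     psi (x *m g *m invmx x) = psi g).

Definition scfUT n (phi : {ffun 'M[F]_n -> C}) : Prop :=
  (forall g, g \notin UT F n -> phi g = 0) /\
  (forall E : {set 'I_n * 'I_n}, indifference E ->
     forall g h, g \in UTo F E -> h \in UTo F E -> phi g = phi h).

Definition zeta n (phi : {ffun 'M[F]_n -> C}) : C :=
  let d := indic (UTo F (set0 : {set 'I_n * 'I_n})) in
  (#|F|%:R - 1) ^+ n * inner (UT F n) phi d / inner (UT F n) d d.

Definition epsilon n (psi : {ffun 'M[F]_n -> C}) : C :=
  let d := indic (regular_unipotent F n) in
  inner (GL F n) psi d / inner (GL F n) d d.

Definition IndUT n (phi : {ffun 'M[F]_n -> C}) : {ffun 'M[F]_n -> C} :=
  induce (UT F n) (GL F n) phi.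

(* A graded space H = \bigoplus_n H_n of functions on the square matrices,
   with the components H_a x H_b -> H_(a+b) of a product and the components
   H_(a+b) -> H_a (x) H_b of a coproduct.  The space H_a (x) H_b is identified
   with its image in the functions of two matrices.  The counit vanishes in
   positive degree, hence is given on H_0.  A linear functional on H, or a
   graded linear map from H, is given by the family of its restrictions
   to the H_n.  Only the structure maps are recorded: a morphism of graded
   connected Hopf algebras is a graded linear map compatible with them, and it
   then commutes with the antipodes.  The Hopf algebra axioms for hopfGL (due
   to Zelevinsky) and hopfUT are not asserted here. *)
Record graded_hopf_data := GradedHopfData {
  piece : forall n, {ffun 'M[F]_n -> C} -> Prop;
  hmul : forall a b, {ffun 'M[F]_a -> C} -> {ffun 'M[F]_b -> C} ->
           {ffun 'M[F]_(a + b) -> C};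
  hone : {ffun 'M[F]_0 -> C};
  hcomul : forall a b, {ffun 'M[F]_(a + b) -> C} ->
             {ffun 'M[F]_a * 'M[F]_b -> C};
  hcounit : {ffun 'M[F]_0 -> C} -> C
}.

Definition lincomb n (k : C) (phi psi : {ffun 'M[F]_n -> C}) :
    {ffun 'M[F]_n -> C} := [ffun g => k * phi g + psi g].

(* f (x) f' on functions of two matrices: f in the first variable, then f' in
   the second. *)
Definition tensor_map a b
    (f : {ffun 'M[F]_a -> C} -> {ffun 'M[F]_a -> C})
    (f' : {ffun 'M[F]_b -> C} -> {ffun 'M[F]_b -> C})
    (Phi : {ffun 'M[F]_a * 'M[F]_b -> C}) : {ffun 'M[F]_a * 'M[F]_b -> C} :=
  [ffun gh => f' [ffun h => f [ffun g => Phi (g, h)] gh.1] gh.2].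

Definition linear_character (H : graded_hopf_data)
    (z : forall n, {ffun 'M[F]_n -> C} -> C) : Prop :=
  [/\ forall n k (phi psi : {ffun 'M[F]_n -> C}),
        piece H phi -> piece H psi ->
        z n (lincomb k phi psi) = k * z n phi + z n psi,
      z 0%N (hone H) = 1
    & forall a b (phi : {ffun 'M[F]_a -> C}) (psi : {ffun 'M[F]_b -> C}),
        piece H phi -> piece H psi ->
        z (a + b)%N (hmul H phi psi) = z a phi * z b psi].

Definition graded_hopf_morphism (H K : graded_hopf_data)
    (f : forall n, {ffun 'M[F]_n -> C} -> {ffun 'M[F]_n -> C}) : Prop :=
  [/\ (forall n (phi : {ffun 'M[F]_n -> C}),
         piece H phi -> piece K (f n phi)) /\
      (forall n k (phi psi : {ffun 'M[F]_n -> C}),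
         piece H phi -> piece H psi ->
         f n (lincomb k phi psi) = lincomb k (f n phi) (f n psi)),
      f 0%N (hone H) = hone K,
      forall a b (phi : {ffun 'M[F]_a -> C}) (psi : {ffun 'M[F]_b -> C}),
        piece H phi -> piece H psi ->
        f (a + b)%N (hmul H phi psi) = hmul K (f a phi) (f b psi),
      forall phi : {ffun 'M[F]_0 -> C},
        piece H phi -> hcounit K (f 0%N phi) = hcounit H phi
    & forall a b (phi : {ffun 'M[F]_(a + b) -> C}),
        piece H phi ->
        hcomul K (f (a + b)%N phi) = tensor_map (f a) (f b) (hcomul H phi)].

Definition CHA_morphism
    (H : graded_hopf_data) (z : forall n, {ffun 'M[F]_n -> C} -> C)
    (K : graded_hopf_data) (e : forall n, {ffun 'M[F]_n -> C} -> C)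
    (f : forall n, {ffun 'M[F]_n -> C} -> {ffun 'M[F]_n -> C}) : Prop :=
  [/\ linear_character H z,
      linear_character K e,
      graded_hopf_morphism H K f
    & forall n (phi : {ffun 'M[F]_n -> C}),
        piece H phi -> z n phi = e n (f n phi)].

Definition one0 : {ffun 'M[F]_0 -> C} := [ffun=> 1].
Definition counit0 (phi : {ffun 'M[F]_0 -> C}) : C := phi 0.

(* Parabolic induction, and averaging over the unipotent radical of the
   parabolic subgroup (its adjoint for the inner products). *)
Definition mulGL a b (phi : {ffun 'M[F]_a -> C}) (psi : {ffun 'M[F]_b -> C}) :
    {ffun 'M[F]_(a + b) -> C} :=
  induce (parabolic F a b) (GL F (a + b))
         (inflate (parabolic F a b) phi psi).

Definition comulGL a b (psi : {ffun 'M[F]_(a + b) -> C}) :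
    {ffun 'M[F]_a * 'M[F]_b -> C} :=
  [ffun gh => (#|F| ^ (a * b))%:R^-1 *
              \sum_(u : 'M[F]_(a, b)) psi (block_mx gh.1 u 0 gh.2)].

Definition hopfGL : graded_hopf_data :=
  @GradedHopfData cfGL mulGL one0 comulGL counit0.

(* Inflation along UT_(a+b) -> UT_a x UT_b; and, summed over all I and J as
   above, restriction to the subgroup UT_I x UT_J |x U_(I,J) of UT_(a+b)
   of matrices with zero J x I block, followed by averaging over its normal
   subgroup U_(I,J). *)
Definition mulUT a b (phi : {ffun 'M[F]_a -> C}) (psi : {ffun 'M[F]_b -> C}) :
    {ffun 'M[F]_(a + b) -> C} := inflate (UT F (a + b)) phi psi.

Definition comulUT a b (phi : {ffun 'M[F]_(a + b) -> C}) :
    {ffun 'M[F]_a * 'M[F]_b -> C} :=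
  [ffun gh => \sum_(w : 'S_(a + b) | shuffle w)
     #|shuffle_radical F w|%:R^-1 *
     \sum_(u in shuffle_radical F w) phi (shuffle_mx w gh.1 u gh.2)].

Definition hopfUT : graded_hopf_data :=
  @GradedHopfData scfUT mulUT one0 comulUT counit0.

End Functions.

(* Main.v *)
Require Import Defs.
From mathcomp Require Import all_boot all_order all_algebra all_fingroup.
From mathcomp Require Import zify ring.
From mathcomp Require Import complex reals.

(* The regular unipotent J, a single Jordan block, stabilizes only one flag, so
   x J x^-1 is unitriangular iff x is upper triangular, and is block upper
   triangular iff x is.  The first fact gives Ind(phi)(J) = (q-1)^n phi(J),
   i.e. zeta = epsilon o Ind; the second gives the multiplicativity of epsilon.
   Ind is compatible with products by transitivity of induction.  For the
   coproducts, GL_(a+b) is cut into the double cosets UT w^-1 P_(a,b), one for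
   each shuffle w, and the average over the radical of P_(a,b) turns the part of
   Ind(phi) coming from w into the summation over w in the coproduct of UT. *)

Set Implicit Arguments.
Unset Strict Implicit.
Unset Printing Implicit Defensive.

Import GRing.Theory Num.Theory.
Local Open Scope ring_scope.

(** * Matrix groups *)

Section MatrixGroups.
Variable F : finFieldType.

(** The factor (q-1)^n is the index of UT in the group of invertible upper triangular matrices. The
    double cosets are never formed as sets. Instead each x in GL is weighted by the pairs (w, t),
    with w a shuffle and t in UT, such that w t x lies in P. Row reduction yields such a pair, all
    pairs for one x share the same w, and the possible t form a coset of a group of order |UT_a|
    |UT_b| |U_w|, where U_w is [shuffle_radical F w]; dividing by this order makes the weights sum
    to 1. The factor |U_w|^-1 becomes the average in [comulUT]. To drop t again, x -> phi(x g x^-1)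
    must be invariant under left translation by UT, that is, superclass functions must be class
    functions of UT. *)

Definition mxgroup n (S : {set 'M[F]_n}) : Prop :=
  [/\ 1%:M \in S, {in S &, forall x y, x *m y \in S} & {subset S <= unitmx}].

Lemma mxgroup_unit n (S : {set 'M[F]_n}) x : mxgroup S -> x \in S -> x \in unitmx.
Proof. by case=> _ _; apply. Qed.

Lemma mulmx_inj n (x : 'M[F]_n) : x \in unitmx -> injective (fun y : 'M_n => x *m y).
Proof. by move=> ux; apply: can_inj (mulKmx ux). Qed.

(** Left multiplication by [x] maps the finite set [S] injectively into itself, hence onto it, so
    [1%:M] has the form [x *m y]. *)
Lemma mxgroup_inv n (S : {set 'M[F]_n}) x :
  mxgroup S -> x \in S -> invmx x \in S.
Proof.
case=> S1 SM Sunit Sx; have ux := Sunit x Sx.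
have /eqP eqS : [set x *m y | y in S] == S.
  rewrite eqEcard card_imset ?leqnn ?andbT; last exact: mulmx_inj.
  by apply/subsetP=> _ /imsetP[y Sy ->]; apply: SM.
move: S1; rewrite -{1}eqS => /imsetP[y Sy xy1].
by rewrite -[invmx x]mulmx1 xy1 mulKmx.
Qed.

Lemma mxgroup_mull n (S : {set 'M[F]_n}) x y :
  mxgroup S -> x \in S -> (x *m y \in S) = (y \in S).
Proof.
move=> gS Sx; have [_ SM _] := gS; apply/idP/idP=> [Sxy|]; last exact: SM.
by rewrite -(mulKmx (mxgroup_unit gS Sx) y); apply: SM; first exact: mxgroup_inv.
Qed.

Lemma mxgroup_mulr n (S : {set 'M[F]_n}) x y :
  mxgroup S -> x \in S -> (y *m x \in S) = (y \in S).
Proof.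
move=> gS Sx; have [_ SM _] := gS; apply/idP/idP=> [Syx|Sy]; last exact: SM.
by rewrite -(mulmxK (mxgroup_unit gS Sx) y); apply: SM; last exact: mxgroup_inv.
Qed.

Lemma mxgroup_conj n (S : {set 'M[F]_n}) x y :
  mxgroup S -> x \in S -> (x *m y *m invmx x \in S) = (y \in S).
Proof. by move=> gS Sx; rewrite mxgroup_mulr ?mxgroup_mull ?mxgroup_inv. Qed.

Lemma mxgroup_card_gt0 n (S : {set 'M[F]_n}) : mxgroup S -> (0 < #|S|)%N.
Proof. by case=> S1 _ _; apply/card_gt0P; exists 1%:M. Qed.

Lemma invmxM n (x y : 'M[F]_n) :
  x \in unitmx -> y \in unitmx -> invmx (x *m y) = invmx y *m invmx x.
Proof.
move=> ux uy; apply: (@mulmx_inj _ (x *m y)); first by rewrite unitmx_mul ux.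
by rewrite mulmxV ?unitmx_mul ?ux // mulmxA mulmxK // mulmxV.
Qed.

Lemma conj_mulmx n (x y g : 'M[F]_n) : x \in unitmx -> y \in unitmx ->
  x *m y *m g *m invmx (x *m y) = x *m (y *m g *m invmx y) *m invmx x.
Proof. by move=> ux uy; rewrite invmxM // !mulmxA. Qed.

Lemma sum_mulmxl (V : nmodType) n (x : 'M[F]_n) (P : pred 'M[F]_n) (f : 'M[F]_n -> V) :
  x \in unitmx -> \sum_(y | P (x *m y)) f (x *m y) = \sum_(y | P y) f y.
Proof.
move=> ux; rewrite [RHS](reindex (fun y => x *m y)) //.
exists (fun y => invmx x *m y) => y _.
  exact: mulKmx.
exact: mulKVmx.
Qed.

Lemma sum_mulmxr (V : nmodType) n (x : 'M[F]_n) (P : pred 'M[F]_n) (f : 'M[F]_n -> V) :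
  x \in unitmx -> \sum_(y | P (y *m x)) f (y *m x) = \sum_(y | P y) f y.
Proof.
move=> ux; rewrite [RHS](reindex (fun y => y *m x)) //.
exists (fun y => y *m invmx x) => y _.
  exact: mulmxK.
exact: mulmxKV.
Qed.

Lemma GLE n (g : 'M[F]_n) : (g \in GL F n) = (g \in unitmx).
Proof. by rewrite inE. Qed.

Lemma mxgroup_GL n : mxgroup (GL F n).
Proof.
split=> [|x y|x]; rewrite ?GLE ?unitmx1 ?unitmx_mul //.
by move=> -> ->.
Qed.

Lemma UTP n (g : 'M[F]_n) :
  reflect ((forall i, g i i = 1) /\ (forall i j : 'I_n, (j < i)%N -> g i j = 0))
          (g \in UT F n).
Proof.
rewrite inE; apply: (iffP andP) => -[g1 g0]; split.
- by move=> i; apply/eqP/(forallP g1).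
- by move=> i j ji; apply/eqP; move/forallP/(_ i)/forallP/(_ j)/implyP: g0; apply.
- by apply/forallP=> i; rewrite g1.
- by apply/forallP=> i; apply/forallP=> j; apply/implyP=> /g0 ->.
Qed.

Definition upper n (g : 'M[F]_n) : Prop :=
  forall i j : 'I_n, (j < i)%N -> g i j = 0.

Lemma upper_det n (g : 'M[F]_n) : upper g -> \det g = \prod_i g i i.
Proof.
move=> g0; rewrite -det_tr det_trig.
  by apply: eq_bigr => i _; rewrite mxE.
by apply/is_trig_mxP=> i j ij; rewrite mxE g0.
Qed.

Lemma upper_mul n (g h : 'M[F]_n) : upper g -> upper h -> upper (g *m h).
Proof.
move=> g0 h0 i j ji; rewrite mxE big1 // => k _.
have [ki|ik] := ltnP k i; first by rewrite g0 // mul0r.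
by rewrite h0 ?mulr0 // (leq_trans ji).
Qed.

Lemma upper_mul_diag n (g h : 'M[F]_n) i :
  upper g -> upper h -> (g *m h) i i = g i i * h i i.
Proof.
move=> g0 h0; rewrite mxE (bigD1 i) //= big1 ?addr0 // => k ki.
case: (ltngtP k i) => [ki'|ik|/val_inj/eqP]; last by rewrite (negPf ki).
  by rewrite g0 // mul0r.
by rewrite h0 // mulr0.
Qed.

Lemma mxgroup_UT n : mxgroup (UT F n).
Proof.
split=> [|x y|x].
- by apply/UTP; split=> [i|i j ji]; rewrite mxE ?eqxx // -val_eqE gtn_eqF.
- move=> /UTP[x1 x0] /UTP[y1 y0]; apply/UTP; split; last exact: upper_mul.
  by move=> i; rewrite upper_mul_diag // x1 y1 mulr1.
- by move=> /UTP[x1 x0]; rewrite unitmxE upper_det // big1 ?unitr1.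
Qed.

End MatrixGroups.

(** * Conjugates of the Jordan block *)

Section Regular.
Variable F : finFieldType.
Implicit Types n : nat.

Local Notation J := (jordan_block F).

Lemma indifference0 n : indifference (set0 : {set 'I_n * 'I_n}).
Proof.
apply/and3P; split; apply/forallP=> i; rewrite ?inE //; apply/forallP=> j.
  by rewrite !inE.
by apply/forallP=> k; apply/forallP=> l; rewrite !inE !andbF.
Qed.

Lemma jordan_blockE n (i j : 'I_n) :
  J n i j = ((i == j) || (i.+1 == j :> nat))%:R.
Proof. by rewrite mxE. Qed.

Lemma jordan_block_UT n : J n \in UT F n.
Proof.
apply/UTP; split=> [i|i j ji]; rewrite jordan_blockE ?eqxx //.
by rewrite -val_eqE gtn_eqF //= gtn_eqF // ltnW.
Qed.

Lemma unitmx_jordan_block n : J n \in unitmx.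
Proof. exact: mxgroup_unit (mxgroup_UT F n) (jordan_block_UT n). Qed.

(** An indifference graph with an edge {i, j}, i < j, also has the edge {i, i+1}, so every matrix in
    its [UTgraph] has a zero on the superdiagonal. *)
Lemma mem_UTo_set0 n (g : 'M[F]_n) : g \in UT F n ->
  (forall i j : 'I_n, i.+1 = j :> nat -> g i j != 0) -> g \in UTo F set0.
Proof.
move=> gU gn0; rewrite inE; apply/andP; split.
  rewrite inE gU /=.
  by apply/forallP=> i; apply/forallP=> j; rewrite inE andbF.
apply/existsP=> -[T /and3P[/and3P[Tirr Tsym Tind] T0 gT]].
have [[i j] Tij] : exists ij, ij \in T by apply/set0Pn; rewrite -proper0.
wlog ij: i j Tij / (i < j)%N.
  move=> th; case: (ltngtP i j) => [|ji|/val_inj eij]; first exact: th.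
    apply: (th j i) => //.
    by move/forallP/(_ i)/forallP/(_ j)/implyP: Tsym; apply.
  by move/forallP/(_ i): Tirr; rewrite {2}eij Tij.
have lt_i1n: (i.+1 < n)%N by apply: leq_ltn_trans (ltn_ord j).
pose k := Ordinal lt_i1n.
have Tik: (i, k) \in T.
  move/forallP/(_ i)/forallP/(_ i)/forallP/(_ k)/forallP/(_ j)/implyP: Tind.
  by apply; rewrite leqnn ltnSn ij.
move: gT; rewrite inE => /andP[_ /forallP/(_ i)/forallP/(_ k)/implyP].
by rewrite /= ltnSn Tik => /(_ isT); apply/negP/gn0.
Qed.

Lemma UTo_set0P n (g : 'M[F]_n) :
  reflect (g \in UT F n /\ forall i j : 'I_n, i.+1 = j :> nat -> g i j != 0)
          (g \in UTo F set0).
Proof.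
apply: (iffP idP) => [|[]]; last exact: mem_UTo_set0.
rewrite inE => /andP[]; rewrite inE => /andP[gU _] /existsP gT; split=> // i j ij.
(* The graph with the single edge {i, i+1} is an indifference graph, and a zero at (i, i+1) would
   put [g] in its [UTgraph]. *)
apply/eqP=> gij; case: gT; exists [set (i, j); (j, i)]; apply/and3P; split.
- apply/and3P; split; apply/forallP=> k.
  + by rewrite !inE !xpair_eqE -!val_eqE /= -ij; lia.
  + by apply/forallP=> l; rewrite !inE !xpair_eqE orbC andbC [X in _ || X]andbC implybb.
  + apply/forallP=> l; apply/forallP=> p; apply/forallP=> m; apply/implyP.
    by rewrite !inE !xpair_eqE -!val_eqE /= -ij; lia.
- by rewrite proper0; apply/set0Pn; exists (i, j); rewrite !inE eqxx.
- rewrite inE gU; apply/forallP=> k; apply/forallP=> l; apply/implyP.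
  rewrite !inE !xpair_eqE -!val_eqE /= -ij => h.
  have /andP[/eqP/val_inj -> /eqP lj] : (k == i :> nat) && (l == i.+1 :> nat) by lia.
  by rewrite (_ : l = j) ?gij //; apply: val_inj; rewrite /= lj.
Qed.

Lemma jordan_block_UTo n : J n \in UTo F set0.
Proof.
apply: mem_UTo_set0 (jordan_block_UT n) _ => i j ij.
by rewrite jordan_blockE ij eqxx orbT oner_eq0.
Qed.

Lemma mulmx_jordan_block m n (x : 'M[F]_(m, n)) i (j k : 'I_n) :
  j.+1 = k :> nat -> (x *m J n) i k = x i k + x i j.
Proof.
move=> jk; rewrite mxE (bigD1 k) //= (bigD1 j) /=; last first.
  by rewrite -val_eqE /= -jk ltn_eqF.
rewrite !jordan_blockE eqxx jk eqxx orbT !mulr1 big1 ?addr0 // => l /andP[lk lj].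
rewrite jordan_blockE (negPf lk) -jk eqSS (_ : (l == j :> nat) = false) ?mulr0 //.
exact: negPf.
Qed.

Definition borel n : {set 'M[F]_n} :=
  [set g | (g \in unitmx) && [forall i : 'I_n, forall j : 'I_n, (j < i)%N ==> (g i j == 0)]].

Lemma borelP n (g : 'M[F]_n) : reflect (g \in unitmx /\ upper g) (g \in borel n).
Proof.
rewrite inE; apply: (iffP andP) => -[ug g0]; split=> //.
  by move=> i j ji; apply/eqP; move/forallP/(_ i)/forallP/(_ j)/implyP: g0; apply.
by apply/forallP=> i; apply/forallP=> j; apply/implyP=> /g0 ->.
Qed.

Lemma upper_unitmx n (g : 'M[F]_n) :
  upper g -> (g \in unitmx) = [forall i, g i i != 0].
Proof.
move=> g0; rewrite unitmxE upper_det // unitfE prodf_seq_neq0.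
apply/allP/forallP => [h i|h i _]; last by rewrite h.
by apply: h; rewrite mem_index_enum.
Qed.

Lemma mxgroup_borel n : mxgroup (borel n).
Proof.
split=> [|x y|x /borelP[] //].
  apply/borelP; split=> [|i j ji]; first exact: unitmx1.
  by rewrite mxE -val_eqE gtn_eqF.
move=> /borelP[ux x0] /borelP[uy y0]; apply/borelP.
by rewrite unitmx_mul ux; split=> //; apply: upper_mul.
Qed.

(** Scaling the rows of a unitriangular matrix by nonzero scalars [d i] is a bijection from the
    torus times [UT] onto the Borel subgroup. *)
Lemma card_borel n : #|borel n| = ((#|F| - 1) ^ n * #|UT F n|)%N.
Proof.
pose D := [set d : {ffun 'I_n -> F} | d \in ffun_on (predC1 0)].
pose f (du : {ffun 'I_n -> F} * 'M[F]_n) := diag_mx (\row_i du.1 i) *m du.2.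
have fE d u i j : f (d, u) i j = d i * u i j by rewrite /f mul_diag_mx !mxE.
have -> : borel n = f @: setX D (UT F n).
  apply/setP=> g; apply/borelP/imsetP=> [[ug g0]|[[d u] /setXP[/= Dd /UTP[u1 u0]] ->]].
    have gn0: [forall i, g i i != 0] by rewrite -upper_unitmx.
    pose d := [ffun i => g i i].
    exists (d, \matrix_(i, j) ((d i)^-1 * g i j)).
      apply/setXP; split=> /=.
        by rewrite inE; apply/ffun_onP=> i; rewrite ffunE inE (forallP gn0).
      apply/UTP; split=> [i|i j /g0 gij]; rewrite !mxE ?gij ?mulr0 // ffunE.
      by rewrite mulVf // (forallP gn0).
    by apply/matrixP=> i j; rewrite fE !mxE ffunE mulVKf // (forallP gn0).
  have up: upper (f (d, u)) by move=> i j ji; rewrite fE u0 // mulr0.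
  split=> //; rewrite upper_unitmx //; apply/forallP=> i; rewrite fE u1 mulr1.
  by move: Dd; rewrite inE => /ffun_onP/(_ i); rewrite inE.
rewrite card_in_imset => [|[d u] [d' u'] /setXP[/= Dd /UTP[u1 u0]] /setXP[/= Dd' /UTP[u1' u0']] e].
  by rewrite cardsX cardsE card_ffun_on cardC1 card_ord subn1.
have ed: d = d'.
  by apply/ffunP=> i; have:= congr1 (fun m : 'M_n => m i i) e; rewrite /= !fE u1 u1' !mulr1.
congr (_, _) => //; apply/matrixP=> i j.
have:= congr1 (fun m : 'M_n => m i j) e; rewrite /= !fE -ed; apply: mulfI.
by move: Dd; rewrite inE => /ffun_onP/(_ i); rewrite inE.
Qed.

(* Comparing the entries of [x *m J n] and [m *m x], row by row from the last
   one, for [m = x *m J n *m invmx x]. *)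
Lemma conj_jordan_UT n (x : 'M[F]_n) : x \in unitmx ->
  (x *m J n *m invmx x \in UT F n) = (x \in borel n).
Proof.
move=> ux; apply/idP/idP => [/UTP[]|/borelP[_ x0]].
  move: (_ *m invmx x) (mulmxKV ux (x *m J n)) => m e m1 m0.
  apply/borelP; split=> //.
  suff low k : forall i j : 'I_n, (n - i <= k)%N -> (j < i)%N -> x i j = 0.
    by move=> i j; apply: (low (n - i)%N).
  elim: k => [|k IHk] i j.
    by rewrite leqn0 subn_eq0 leqNgt ltn_ord.
  move=> ik ji; have lt_j1n: (j.+1 < n)%N by apply: leq_ltn_trans (ltn_ord i).
  (* In column j+1, [x *m J n] has the entry x i (j+1) + x i j. In [m *m x] the terms l < i vanish
     by [m0] and those with l > i by induction, since j+1 <= i < l; only x i (j+1) is left, so x i j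
     = 0. *)
  have := congr1 (fun m : 'M_n => m i (Ordinal lt_j1n)) e.
  rewrite /= (@mulmx_jordan_block _ _ _ _ j) // mxE (bigD1 i) //= m1 mul1r.
  rewrite big1 => [/addrI|l li]; first by move=> ->.
  case: (ltngtP l i) => [li'|il|/val_inj/eqP]; last by rewrite (negPf li).
    by rewrite m0 // mul0r.
  rewrite IHk ?mulr0 //; last exact: leq_ltn_trans il.
  by rewrite -ltnS (leq_trans _ ik) // ltn_sub2l // (ltn_trans il).
have gB := mxgroup_borel n.
have xB: x \in borel n by apply/borelP.
have /borelP[_ x'0] := mxgroup_inv gB xB.
have /UTP[J1 J0] := jordan_block_UT n.
apply/UTP; split=> [i|]; last by do 2?apply: upper_mul.
have xx': (x *m invmx x) i i = 1 by rewrite mulmxV // mxE eqxx.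
by rewrite upper_mul_diag ?upper_mul_diag // ?J1 ?mulr1 -?upper_mul_diag //; apply: upper_mul.
Qed.

(** If the conjugate [m] had a zero at (i, i+1), comparing the entries of [x *m J n] and [m *m x]
    there would give x i i = 0: below row i+1, column i+1 of [x] is zero. *)
Lemma conj_jordan_UTo n (x : 'M[F]_n) : x \in borel n ->
  x *m J n *m invmx x \in UTo F set0.
Proof.
move=> xB; have /borelP[ux x0] := xB.
have : x *m J n *m invmx x \in UT F n by rewrite conj_jordan_UT.
move: (_ *m invmx x) (mulmxKV ux (x *m J n)) => m e mU.
apply: mem_UTo_set0 => // i j ij; apply/eqP=> mij.
have xn0 k : x k k != 0 by move: ux; rewrite upper_unitmx // => /forallP.
have /UTP[m1 m0] := mU.
have := congr1 (fun m : 'M_n => m i j) e.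
rewrite /= (@mulmx_jordan_block _ _ _ _ i) // mxE (bigD1 i) //= m1 mul1r.
rewrite big1 => [/addrI/esym/eqP|l li]; first by rewrite (negPf (xn0 i)).
case: (ltngtP l i) => [li'|il|/val_inj/eqP]; last by rewrite (negPf li).
  by rewrite m0 // mul0r.
have [jl|] := ltnP j l; first by rewrite x0 ?mulr0.
rewrite -ij leq_eqVlt ltnS leqNgt il orbF => /eqP lj.
by rewrite (_ : l = j) ?mij ?mul0r //; apply: val_inj; rewrite /= lj.
Qed.

End Regular.

(** * Values at regular unipotents *)

Section Evaluation.
Variables (F : finFieldType) (C : numClosedFieldType).
Implicit Types n : nat.

Local Notation J := (jordan_block F).

Lemma card_mxgroup_neq0 n (S : {set 'M[F]_n}) : mxgroup S -> #|S|%:R != 0 :> C.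
Proof. by move=> /mxgroup_card_gt0; rewrite pnatr_eq0 lt0n. Qed.

Lemma inner_indic n (G A : {set 'M[F]_n}) (phi : {ffun 'M[F]_n -> C}) c :
  A \subset G -> {in A, forall g, phi g = c} ->
  inner G phi (indic C A) = #|G|%:R^-1 * (c * #|A|%:R).
Proof.
move=> /subsetP AG phiA; rewrite /inner; congr (_ * _).
rewrite (bigID (mem A)) /= [X in _ + X]big1 ?addr0 => [|g /andP[_ gA]]; last first.
  by rewrite ffunE (negPf gA) conjC0 mulr0.
rewrite mulr_natr -sumr_const; apply: eq_big => [g|g /andP[_ gA]].
  by apply: andb_idl => /AG.
by rewrite ffunE gA conjC1 mulr1 phiA.
Qed.

(** The factors |G|^-1 and |A| cancel. This turns [epsilon], and [zeta] up to its power of q-1, into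
    evaluation at the Jordan block. *)
Lemma inner_indic_ratio n (G A : {set 'M[F]_n}) (phi : {ffun 'M[F]_n -> C}) x :
  A \subset G -> x \in A -> {in A, forall g, phi g = phi x} ->
  inner G phi (indic C A) / inner G (indic C A) (indic C A) = phi x.
Proof.
move=> AG Ax phiA; rewrite (inner_indic AG phiA) (@inner_indic _ _ _ _ 1) //; last first.
  by move=> g gA; rewrite ffunE gA.
have G0 : #|G|%:R != 0 :> C.
  by rewrite pnatr_eq0 -lt0n; apply/card_gt0P; exists x; apply: (subsetP AG).
have A0 : #|A|%:R != 0 :> C by rewrite pnatr_eq0 -lt0n; apply/card_gt0P; exists x.
by rewrite mul1r mulrCA mulfK // mulf_neq0 ?invr_neq0.
Qed.

(** Stated for functions constant on this one superclass, so that it applies directly to a product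
    [mulUT phi psi]. *)
Lemma zetaE n (phi : {ffun 'M[F]_n -> C}) :
  {in UTo F set0, forall g, phi g = phi (J n)} ->
  zeta phi = (#|F|%:R - 1) ^+ n * phi (J n).
Proof.
move=> phiE; rewrite /zeta /= -mulrA (@inner_indic_ratio _ _ _ _ (J n)) //.
  by apply/subsetP=> g /UTo_set0P[].
exact: jordan_block_UTo.
Qed.

Lemma scfUT_UTo_set0 n (phi : {ffun 'M[F]_n -> C}) : scfUT phi ->
  {in UTo F set0, forall g, phi g = phi (J n)}.
Proof.
move=> [_ phiE] g gU; apply: (phiE set0 (indifference0 n) _ _ gU).
exact: jordan_block_UTo.
Qed.

Lemma regular_unipotentP n (g : 'M[F]_n) :
  reflect (exists2 x, x \in unitmx & g = x *m J n *m invmx x)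
          (g \in regular_unipotent F n).
Proof.
apply: (iffP imsetP) => -[x].
  by rewrite GLE => ux ->; exists x.
by move=> ux ->; exists x; rewrite ?GLE.
Qed.

Lemma epsilonE n (psi : {ffun 'M[F]_n -> C}) : cfGL psi -> epsilon psi = psi (J n).
Proof.
move=> [_ psiJ]; apply: inner_indic_ratio.
- apply/subsetP=> _ /regular_unipotentP[x ux ->].
  by rewrite mxgroup_conj ?GLE ?unitmx_jordan_block //; apply: mxgroup_GL.
- apply/regular_unipotentP; exists 1%:M; first exact: unitmx1.
  by rewrite invmx1 mul1mx mulmx1.
- by move=> _ /regular_unipotentP[x ux ->]; rewrite psiJ // GLE ?unitmx_jordan_block.
Qed.

Lemma induceE n (H G : {set 'M[F]_n}) (phi : {ffun 'M[F]_n -> C}) g :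
  (forall h, h \notin H -> phi h = 0) ->
  induce H G phi g = #|H|%:R^-1 * \sum_(x in G) phi (x *m g *m invmx x).
Proof.
move=> phi0; rewrite ffunE; congr (_ * _); rewrite big_mkcondr.
by apply: eq_bigr => x _; case: ifPn => // /phi0.
Qed.

Lemma IndUTE n (phi : {ffun 'M[F]_n -> C}) g : scfUT phi ->
  IndUT phi g = #|UT F n|%:R^-1 * \sum_(x in GL F n) phi (x *m g *m invmx x).
Proof. by move=> [phi0 _]; apply: induceE. Qed.

Lemma cfGL_induce n (H : {set 'M[F]_n}) (phi : {ffun 'M[F]_n -> C}) :
  H \subset GL F n -> cfGL (induce H (GL F n) phi).
Proof.
move=> /subsetP HG; split=> [g gG|x g xG gG]; rewrite !ffunE.
  rewrite big_pred0 ?mulr0 // => x; apply/andP=> -[xG /HG].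
  by rewrite mxgroup_conj ?(negPf gG) //; apply: mxgroup_GL.
rewrite GLE in xG; congr (_ * _); rewrite -[RHS](sum_mulmxr _ _ xG).
have e y : y \in unitmx ->
    y *m x *m g *m invmx (y *m x) = y *m (x *m g *m invmx x) *m invmx y.
  by move=> uy; rewrite conj_mulmx.
apply: eq_big => y; rewrite !GLE.
  by rewrite unitmx_mul xG andbT; apply: andb_id2l => /e ->.
by case/andP=> /e ->.
Qed.

Lemma cfGL_IndUT n (phi : {ffun 'M[F]_n -> C}) : cfGL (IndUT phi).
Proof.
apply: cfGL_induce; apply/subsetP=> g.
by rewrite GLE; apply: mxgroup_unit (mxgroup_UT F n).
Qed.

Lemma cfGL_mulGL a b (phi : {ffun 'M[F]_a -> C}) (psi : {ffun 'M[F]_b -> C}) :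
  cfGL (mulGL phi psi).
Proof.
apply: cfGL_induce; apply/subsetP=> g.
by rewrite GLE inE => /andP[].
Qed.

Lemma zeta_epsilon_Ind n (phi : {ffun 'M[F]_n -> C}) :
  scfUT phi -> zeta phi = epsilon (IndUT phi).
Proof.
move=> scf_phi; have phi0 := scf_phi.1.
have phiE := scfUT_UTo_set0 scf_phi.
rewrite epsilonE ?zetaE ?IndUTE //; last exact: cfGL_IndUT.
have UT0 := card_mxgroup_neq0 (mxgroup_UT F n).
apply: (mulfI UT0); rewrite mulVKf // (bigID (mem (borel F n))) /= addrC big1 => [|x]; last first.
  by case/andP=> xG xB; rewrite phi0 // conj_jordan_UT // -GLE.
rewrite add0r (eq_bigr (fun _ => phi (J n))) => [|x /andP[_ xB]]; last first.
  by rewrite phiE ?conj_jordan_UTo.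
rewrite (eq_bigl (mem (borel F n))) => [|x]; last first.
  by apply: andb_idl => /borelP[]; rewrite GLE.
(* The subtraction in [card_borel] is truncated, hence the check that |F| is positive. *)
rewrite sumr_const card_borel -[RHS]mulr_natl natrM natrX natrB; last first.
  by apply/card_gt0P; exists 0.
by rewrite mulrA [_ * #|_|%:R]mulrC.
Qed.

End Evaluation.

(** * Block triangular matrices *)

Section Blocks.
Variable F : finFieldType.
Variables a b : nat.
Implicit Types (A : {set 'M[F]_a}) (B : {set 'M[F]_b}) (R : {set 'M[F]_(a, b)}).

(** [UT], the parabolic, and its intersections with the conjugates of [UT] by shuffles all have this
    shape, so their orders and the sums over them split over the three blocks. *)
Definition blocks A B R : {set 'M[F]_(a + b)} :=
  [set m : 'M_(a + b) | [&& ulsubmx m \in A, drsubmx m \in B, ursubmx m \in R & dlsubmx m == 0]].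

Lemma mem_blocks A B R y v z :
  (block_mx y v 0 z \in blocks A B R) = [&& y \in A, z \in B & v \in R].
Proof. by rewrite inE block_mxKul block_mxKdr block_mxKur block_mxKdl eqxx andbT. Qed.

Lemma blocksP A B R m :
  reflect (exists y v z, [/\ m = block_mx y v 0 z, y \in A, z \in B & v \in R])
          (m \in blocks A B R).
Proof.
rewrite inE; apply: (iffP and4P) => [[mA mB mR /eqP m0]|[y [v [z [-> yA zB vR]]]]].
  exists (ulsubmx m), (ursubmx m), (drsubmx m).
  by split=> //; rewrite -m0 submxK.
by rewrite block_mxKul block_mxKdr block_mxKur block_mxKdl eqxx.
Qed.

(** The operation is arbitrary in order to serve both cardinals in [nat] and sums in [C]. *)
Lemma big_blocks (T : Type) (idx : T) (op : Monoid.com_law idx) A B R f :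
  \big[op/idx]_(m in blocks A B R) f m =
  \big[op/idx]_(y in A) \big[op/idx]_(z in B) \big[op/idx]_(v in R) f (block_mx y v 0 z).
Proof.
transitivity (\big[op/idx]_(p | (p.1 \in A) && ((p.2.1 \in B) && (p.2.2 \in R)))
    f (block_mx p.1 p.2.2 0 p.2.1)); last first.
  rewrite -(pair_big (mem A) (fun q => (q.1 \in B) && (q.2 \in R))
    (fun y q => f (block_mx y q.2 0 q.1))).
  by apply: eq_bigr => y _; rewrite (pair_big (mem B) (mem R) (fun z v => f (block_mx y v 0 z))).
rewrite (reindex_onto (fun p : 'M_a * ('M_b * 'M_(a, b)) => block_mx p.1 p.2.2 0 p.2.1)
  (fun m => (ulsubmx m, (drsubmx m, ursubmx m)))) /=; last first.
  by move=> _ /blocksP[y [v [z [-> _ _ _]]]]; rewrite block_mxKul block_mxKdr block_mxKur.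
apply: eq_bigl => -[y [z v]] /=.
by rewrite mem_blocks block_mxKul block_mxKdr block_mxKur eqxx andbT.
Qed.

Lemma card_blocks A B R : #|blocks A B R| = (#|A| * #|B| * #|R|)%N.
Proof.
rewrite -sum1_card big_blocks.
rewrite (eq_bigr (fun _ => #|B| * #|R|)%N) => [|y _]; first by rewrite sum_nat_const mulnA.
by rewrite (eq_bigr (fun _ => #|R|)) ?sum_nat_const // => z _; rewrite muln1.
Qed.

Lemma block_UT (y : 'M[F]_a) v (z : 'M[F]_b) :
  (block_mx y v 0 z \in UT F (a + b)) = (y \in UT F a) && (z \in UT F b).
Proof.
apply/UTP/andP=> [[m1 m0]|[/UTP[y1 y0] /UTP[z1 z0]]].
  split; apply/UTP; split.
  - by move=> i; rewrite -(m1 (lshift b i)) block_mxEul.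
  - by move=> i j ji; rewrite -(m0 (lshift b i) (lshift b j)) ?block_mxEul.
  - by move=> i; rewrite -(m1 (rshift a i)) block_mxEdr.
  - by move=> i j ji; rewrite -(m0 (rshift a i) (rshift a j)) ?block_mxEdr //= ltn_add2l.
split=> [i|i j].
  by case: (split_ordP i) => k ->; rewrite ?block_mxEul ?block_mxEdr ?y1 ?z1.
case: (split_ordP i) => k ->; case: (split_ordP j) => l -> /=.
- by rewrite block_mxEul; apply: y0.
- by rewrite ltnNge (leq_trans (ltnW (ltn_ord k))) ?leq_addr.
- by rewrite block_mxEdl mxE.
- by rewrite ltn_add2l block_mxEdr; apply: z0.
Qed.

Lemma UT_blocks : UT F (a + b) = blocks (UT F a) (UT F b) setT.
Proof.
apply/setP=> m; apply/idP/blocksP=> [mU|[y [v [z [-> yU zU _]]]]]; last by rewrite block_UT yU.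
have m0: dlsubmx m = 0.
  have /UTP[_ m0] := mU; apply/matrixP=> i j; rewrite !mxE; apply: m0 => /=.
  by rewrite (leq_trans (ltn_ord j)) ?leq_addr.
move: mU; rewrite -{1}[m]submxK m0 block_UT => /andP[yU zU].
by exists (ulsubmx m), (ursubmx m), (drsubmx m); split; rewrite ?in_setT // -m0 submxK.
Qed.

Lemma parabolic_blocks : parabolic F a b = blocks (GL F a) (GL F b) setT.
Proof.
apply/setP=> m; rewrite [LHS]inE [RHS]inE !GLE in_setT andbA; apply: andb_id2r => /eqP m0.
by rewrite -{1}[m]submxK m0 !unitmxE det_ublock unitrM.
Qed.

Lemma mulmx_ublock (y y' : 'M[F]_a) v v' (z z' : 'M[F]_b) :
  block_mx y v 0 z *m block_mx y' v' 0 z' =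
  block_mx (y *m y') (y *m v' + v *m z') 0 (z *m z').
Proof. by rewrite mulmx_block !mulmx0 !mul0mx !addr0 add0r. Qed.

Lemma mxgroup_parabolic : mxgroup (parabolic F a b).
Proof.
rewrite parabolic_blocks; split=> [|m m'|m].
- by rewrite scalar_mx_block mem_blocks !GLE !unitmx1 inE.
- move=> /blocksP[y [v [z [-> yU zU _]]]] /blocksP[y' [v' [z' [-> yU' zU' _]]]].
  move: yU zU yU' zU'; rewrite mulmx_ublock mem_blocks in_setT !GLE !unitmx_mul.
  by move=> -> -> -> ->.
- by rewrite -parabolic_blocks inE => /andP[].
Qed.

Lemma invmx_ublock (y : 'M[F]_a) v (z : 'M[F]_b) : y \in unitmx -> z \in unitmx ->
  invmx (block_mx y v 0 z) =
  block_mx (invmx y) (- (invmx y *m v *m invmx z)) 0 (invmx z).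
Proof.
move=> uy uz; have um: block_mx y v 0 z \in unitmx.
  by rewrite unitmxE det_ublock unitrM -!unitmxE uy.
apply: (mulmx_inj um); rewrite mulmxV // mulmx_ublock !mulmxV // mulmxN.
by rewrite !mulmxA mulmxV // mul1mx addNr -scalar_mx_block.
Qed.

(** The upper right block is arranged as an affine function of [u], with the constant term in
    parentheses, in view of a change of variable in sums over the unipotent radical. *)
Lemma conj_ublock (y g : 'M[F]_a) v u (z h : 'M[F]_b) : y \in unitmx -> z \in unitmx ->
  block_mx y v 0 z *m block_mx g u 0 h *m invmx (block_mx y v 0 z) =
  block_mx (y *m g *m invmx y)
    (y *m u *m invmx z + (v *m h *m invmx z - y *m g *m invmx y *m v *m invmx z))
    0 (z *m h *m invmx z).
Proof.
move=> uy uz; rewrite invmx_ublock // !mulmx_ublock; congr block_mx.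
by rewrite mulmxDl mulmxN !mulmxA addrC addrA.
Qed.

End Blocks.

(** * Conjugates of the Jordan block in the parabolic subgroup *)

Section Parabolic.
Variable F : finFieldType.

Local Notation J := (jordan_block F).

(** The minimal polynomial divides X^k, so it is some X^m up to a unit, and m <= n+1 because it
    divides the characteristic polynomial. *)
Lemma nilpotent_mx_exp n k (D : 'M[F]_n.+1) : D ^+ k = 0 -> D ^+ n.+1 = 0.
Proof.
have hornerX m : horner_mx D (('X - 0%:P) ^+ m) = D ^+ m.
  by rewrite subr0 rmorphXn /= horner_mx_X.
move=> Dk0; have /dvdp_exp_XsubCP[m _ eqp] : mxminpoly D %| ('X - 0%:P) ^+ k.
  by apply: mxminpoly_min; rewrite hornerX.
have Dm0 : D ^+ m = 0.
  by apply/eqP; rewrite -hornerX -dvd_mxminpoly (eqp_dvdl _ eqp) dvdpp.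
have /dvdp_leq := mxminpoly_dvd_char D.
rewrite monic_neq0 ?char_poly_monic // size_char_poly (eqp_size eqp) size_exp_XsubC ltnS.
move=> /(_ isT) le_mn; have -> : D ^+ n.+1 = D ^+ m * D ^+ (n.+1 - m).
  by rewrite -exprD subnKC.
by rewrite Dm0 mul0r.
Qed.

Lemma UT_sub_parabolic a b : UT F (a + b) \subset parabolic F a b.
Proof.
apply/subsetP=> m; rewrite UT_blocks parabolic_blocks => /blocksP[y [v [z [-> yU zU _]]]].
by rewrite mem_blocks !GLE !(mxgroup_unit (mxgroup_UT F _)) // in_setT.
Qed.

Lemma iter_jordan_shift m n k (W : 'M[F]_(m, n)) i (j l : 'I_n) :
  (j + k)%N = l -> iter k (fun X => X *m (J n - 1%:M)) W i l = W i j.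
Proof.
elim: k l => [|k IHk] l /= jkl; first by congr (W _ _); apply: val_inj; rewrite /= -jkl addn0.
have lt_jkn : (j + k < n)%N by apply: leq_trans (ltn_ord l); rewrite -jkl addnS.
rewrite mulmxBr mulmx1 mxE [X in _ + X]mxE (@mulmx_jordan_block _ _ _ _ _ (Ordinal lt_jkn)).
  by rewrite addrAC subrr add0r IHk.
by rewrite /= -jkl addnS.
Qed.

Lemma iter_jordan_shift0 m n k (W : 'M[F]_(m, n)) i (l : 'I_n) :
  (l < k)%N -> iter k (fun X => X *m (J n - 1%:M)) W i l = 0.
Proof.
elim: k l => // k IHk [[|l] lt_ln] /= lk; rewrite mulmxBr mulmx1 mxE [X in _ + X]mxE.
  rewrite mxE (bigD1 (Ordinal lt_ln)) //= jordan_blockE eqxx mulr1 big1 ?addr0 ?subrr // => p p0.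
  by rewrite jordan_blockE (negPf p0) mulr0.
rewrite (@mulmx_jordan_block _ _ _ _ _ (Ordinal (ltnW lt_ln))) //.
by rewrite addrAC subrr add0r IHk.
Qed.

(* The last [b] rows [W] of [x] satisfy [W *m (J - 1) = (D - 1) *m W], where
   [D] is the lower diagonal block of the conjugate; so [D - 1] is nilpotent of
   size [b], whereas right multiplication by [J - 1] shifts the columns. *)
Lemma conj_jordan_parabolic a b (x : 'M[F]_(a + b)) : x \in unitmx ->
  (x *m J (a + b) *m invmx x \in parabolic F a b) = (x \in parabolic F a b).
Proof.
move=> ux; have gP := mxgroup_parabolic F a b.
apply/idP/idP=> [|xP]; last first.
  by rewrite mxgroup_conj // (subsetP (UT_sub_parabolic a b)) ?jordan_block_UT.
move: (_ *m invmx x) (mulmxKV ux (x *m J (a + b))) => m e.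
rewrite {1}parabolic_blocks => /blocksP[y [v [D [def_m _ _ _]]]].
rewrite inE ux; case: b => [|b] in x ux gP m e v D def_m *.
  by apply/eqP/matrixP=> -[].
set W := dsubmx x; set N := J (a + b.+1) - 1%:M.
have WN : W *m N = (D - 1) *m W.
  rewrite /N mulmxBr mulmx1 mulmxBl mul1mx /W mul_dsub_mx -e def_m -{1}[x]vsubmxK.
  by rewrite mul_block_col col_mxKd mul0mx add0r.
have iterN k : iter k (fun X => X *m N) W = (D - 1) ^+ k *m W.
  elim: k => [|k IHk]; first by rewrite mul1mx.
  by rewrite iterS IHk -mulmxA WN exprSr mulmxA.
have DN : (D - 1) ^+ b.+1 = 0.
  apply: (@nilpotent_mx_exp _ (a + b.+1)).
  (* [W] consists of rows of an invertible matrix, so it has a right inverse; since enough shifts by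
     [N] empty [W], the same power of D - 1 is zero. *)
  have W1 : W *m rsubmx (invmx x) = 1%:M.
    rewrite /W mul_dsub_mx mulmx_rsub mulmxV // scalar_mx_block.
    by rewrite block_mxEh row_mxKr col_mxKd.
  rewrite -[LHS]mulmx1 -W1 mulmxA -iterN.
  suff -> : iter (a + b.+1) (fun X => X *m N) W = 0 by rewrite mul0mx.
  by apply/matrixP=> i j; rewrite iter_jordan_shift0 // mxE.
apply/eqP/matrixP=> i j; rewrite mxE [RHS]mxE.
(* As j < a, column j of [W] is still inside the matrix after a shift by b+1 places, where it meets
   (D - 1)^(b+1) W = 0. *)
have lt_jn : (j + b.+1 < a + b.+1)%N by rewrite ltn_add2r.
have := iterN b.+1; rewrite DN mul0mx => /matrixP/(_ i (Ordinal lt_jn)).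
rewrite [RHS]mxE (@iter_jordan_shift _ _ _ _ _ (lshift b.+1 j)) //.
Qed.
End Parabolic.

(** * Products *)

Section Products.
Variables (F : finFieldType) (C : numClosedFieldType).
Variables a b : nat.

Local Notation J := (jordan_block F).

Lemma jordan_ublock :
  J (a + b) = block_mx (J a) (ursubmx (J (a + b))) 0 (J b).
Proof.
have /UTP[_ J0] := jordan_block_UT F (a + b).
rewrite -{1}[J (a + b)]submxK; congr block_mx; apply/matrixP=> i j; rewrite !mxE /=.
- by rewrite -val_eqE.
- by rewrite -[LHS]jordan_blockE J0 //= (leq_trans (ltn_ord j)) ?leq_addr.
- by rewrite -val_eqE /= -addnS !eqn_add2l.
Qed.

Lemma inflateE (H : {set 'M[F]_(a + b)}) (phi : {ffun 'M[F]_a -> C})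
    (psi : {ffun 'M[F]_b -> C}) y v z :
  block_mx y v 0 z \in H -> inflate H phi psi (block_mx y v 0 z) = phi y * psi z.
Proof. by move=> mH; rewrite ffunE mH block_mxKul block_mxKdr. Qed.

Lemma epsilon_mulGL (phi : {ffun 'M[F]_a -> C}) (psi : {ffun 'M[F]_b -> C}) :
  cfGL phi -> cfGL psi -> epsilon (mulGL phi psi) = epsilon phi * epsilon psi.
Proof.
move=> cphi cpsi; rewrite (epsilonE cphi) (epsilonE cpsi) epsilonE; last exact: cfGL_mulGL.
have gP := mxgroup_parabolic F a b.
apply: (mulfI (card_mxgroup_neq0 C gP)).
rewrite /mulGL induceE => [|h hP]; last by rewrite ffunE (negPf hP).
rewrite mulVKf ?card_mxgroup_neq0 // (bigID (mem (parabolic F a b))) /=.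
rewrite addrC big1 => [|x]; last first.
  rewrite GLE => /andP[ux xP].
  by rewrite ffunE conj_jordan_parabolic // (negPf xP).
rewrite add0r (eq_bigl (mem (parabolic F a b))) => [|x]; last first.
  by rewrite GLE; apply: andb_idl; apply: mxgroup_unit gP.
(* On the parabolic all terms are equal: the diagonal blocks of the conjugate are conjugates of
   [J a] and [J b]. *)
rewrite mulr_natl -sumr_const; apply: eq_bigr => x xP.
have : x *m J (a + b) *m invmx x \in parabolic F a b.
  by rewrite conj_jordan_parabolic // (mxgroup_unit gP).
move: xP; rewrite {1}parabolic_blocks => /blocksP[y [v [z [-> yG zG _]]]].
rewrite jordan_ublock conj_ublock -?GLE // => /inflateE ->.
by rewrite cphi.2 ?cpsi.2 // GLE unitmx_jordan_block.
Qed.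

(** The superdiagonal entries of the diagonal blocks of [g] are among those of [g], so both blocks
    stay in the superclass of the empty graph. *)
Lemma zeta_mulUT (phi : {ffun 'M[F]_a -> C}) (psi : {ffun 'M[F]_b -> C}) :
  scfUT phi -> scfUT psi -> zeta (mulUT phi psi) = zeta phi * zeta psi.
Proof.
move=> /scfUT_UTo_set0 phiE /scfUT_UTo_set0 psiE.
have JE : mulUT phi psi (J (a + b)) = phi (J a) * psi (J b).
  by rewrite jordan_ublock inflateE // -jordan_ublock jordan_block_UT.
rewrite zetaE => [|g /UTo_set0P[gU gn0]].
  by rewrite JE !zetaE // exprD mulrACA.
rewrite JE; have := gU; rewrite {1}UT_blocks => /blocksP[y [v [z [def_g yU zU _]]]].
rewrite def_g in gU gn0 *; rewrite inflateE // phiE ?psiE //.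
  apply/UTo_set0P; split=> // i j ij; move: (gn0 (rshift a i) (rshift a j)).
  by rewrite block_mxEdr; apply; rewrite /= -ij addnS.
apply/UTo_set0P; split=> // i j ij; move: (gn0 (lshift b i) (lshift b j)).
by rewrite block_mxEul; apply.
Qed.

Lemma IndUT_mulUT (phi : {ffun 'M[F]_a -> C}) (psi : {ffun 'M[F]_b -> C}) :
  scfUT phi -> scfUT psi -> IndUT (mulUT phi psi) = mulGL (IndUT phi) (IndUT psi).
Proof.
move=> scf_phi scf_psi; apply/ffunP=> g.
set I := mulUT phi psi.
have I0 h : h \notin UT F (a + b) -> I h = 0 by move=> hU; rewrite ffunE (negPf hU).
(* This also holds outside [UT], where [phi y] or [psi z] vanishes. *)
have IE y v z : I (block_mx y v 0 z) = phi y * psi z.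
  rewrite ffunE block_mxKul block_mxKdr block_UT; case: andP => // /andP; rewrite negb_and.
  by case/orP=> [/scf_phi.1|/scf_psi.1] ->; rewrite (mul0r, mulr0).
have gG n := mxgroup_GL F n; have gP := mxgroup_parabolic F a b.
rewrite [LHS]induceE // [RHS]induceE => [|h hP]; last by rewrite ffunE (negPf hP).
set S := \sum_(x in GL F (a + b)) I _.
(* Off the parabolic both sides vanish, since diag(y, z) normalizes the parabolic, which contains
   [UT]. The element diag(y, z) is then absorbed by a translation in the sum over GL. *)
have key m : inflate (parabolic F a b) (IndUT phi) (IndUT psi) m =
    #|UT F a|%:R^-1 * #|UT F b|%:R^-1 *
    \sum_(y in GL F a) \sum_(z in GL F b)
      I (block_mx y 0 0 z *m m *m invmx (block_mx y 0 0 z)).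
  rewrite ffunE; case: ifPn => [|mP].
    rewrite parabolic_blocks => /blocksP[y [v [z [-> yG zG _]]]].
    rewrite block_mxKul block_mxKdr !IndUTE // mulrACA; congr (_ * _).
    rewrite big_distrl /=; apply: eq_bigr => y' y'G.
    rewrite big_distrr /=; apply: eq_bigr => z' z'G.
    by rewrite conj_ublock -?GLE // IE.
  rewrite big1 ?mulr0 // => y yG; rewrite big1 // => z zG; rewrite I0 //.
  apply: contra mP => /(subsetP (UT_sub_parabolic F a b)).
  by rewrite mxgroup_conj // parabolic_blocks mem_blocks yG zG inE.
rewrite (eq_bigr _ (fun x _ => key _)) -big_distrr /= exchange_big /=.
rewrite (eq_bigr (fun _ => #|GL F b|%:R * S)) => [|y yG]; last first.
  rewrite exchange_big /= mulr_natl -sumr_const; apply: eq_bigr => z zG.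
  have pG : block_mx y 0 0 z \in GL F (a + b).
    by move: yG zG; rewrite !GLE !unitmxE det_ublock unitrM => -> ->.
  have up : block_mx y 0 0 z \in unitmx by rewrite -GLE.
  rewrite -[RHS](sum_mulmxl _ _ up); apply: eq_big => x.
    by rewrite mxgroup_mull.
  by rewrite GLE => ux /=; rewrite conj_mulmx.
(* The remaining constant |GL_a| |GL_b| / (|UT_a| |UT_b| |P|) is 1 / |UT|, as P and UT have the same
   upper right block. *)
rewrite sumr_const -(mulr_natl (_ * S)) parabolic_blocks UT_blocks !card_blocks !natrM.
have xG := card_mxgroup_neq0 C (gG a); have yG := card_mxgroup_neq0 C (gG b).
have xU := card_mxgroup_neq0 C (mxgroup_UT F a); have yU := card_mxgroup_neq0 C (mxgroup_UT F b).
have R0 : #|[set: 'M[F]_(a, b)]|%:R != 0 :> C.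
  by rewrite pnatr_eq0 -lt0n; apply/card_gt0P; exists 0.
by field; rewrite xG yG xU yU R0.
Qed.

End Products.

(** * Superclass functions are class functions *)

Section Superclass.
Variables (F : finFieldType) (C : numClosedFieldType).
Variable n : nat.

Lemma UTgraphP (T : {set 'I_n * 'I_n}) (g : 'M[F]_n) :
  reflect (g \in UT F n /\ forall i j : 'I_n, (i < j)%N -> (i, j) \in T -> g i j = 0)
          (g \in UTgraph F T).
Proof.
rewrite [X in reflect _ X]inE; apply: (iffP andP) => -[gU gT]; split=> //.
  by move=> i j ij Tij; move/forallP/(_ i)/forallP/(_ j)/implyP: gT; rewrite ij Tij => /(_ isT)/eqP.
by apply/forallP=> i; apply/forallP=> j; apply/implyP=> /andP[ij Tij]; rewrite gT.
Qed.

(* If [(i, l)] is in [T], then [g] agrees with the identity in all the entries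
   [(j, k)] with [i <= j] and [k <= l], the only ones that contribute. *)
Lemma UTgraph_conj_sub (T : {set 'I_n * 'I_n}) (t g : 'M[F]_n) : indifference T ->
  t \in UT F n -> g \in UTgraph F T -> t *m g *m invmx t \in UTgraph F T.
Proof.
move=> /and3P[_ _ Tind] tU /UTgraphP[gU gT]; have gUT := mxgroup_UT F n.
apply/UTgraphP; split=> [|i l il Til]; first by rewrite mxgroup_conj.
have /UTP[_ t0] := tU; have /UTP[_ t'0] := mxgroup_inv gUT tU.
have /UTP[g1 g0] := gU.
have -> : (t *m g *m invmx t) i l = (t *m 1%:M *m invmx t) i l.
  rewrite !mxE; apply: eq_bigr => k _; rewrite !mxE.
  have [lk|kl] := ltnP l k; first by rewrite t'0 // !mulr0.
  congr (_ * _); apply: eq_bigr => j _.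
  have [ji|ij] := ltnP j i; first by rewrite t0 // !mul0r.
  congr (_ * _); rewrite mxE; case: (ltngtP j k) => [jk|kj|/val_inj ->].
  - rewrite -val_eqE ltn_eqF // gT //.
    move/forallP/(_ i)/forallP/(_ j)/forallP/(_ k)/forallP/(_ l)/implyP: Tind; apply.
    by rewrite ij jk kl.
  - by rewrite -val_eqE gtn_eqF // g0.
  - by rewrite g1 eqxx.
by rewrite mulmx1 mulmxV ?(mxgroup_unit gUT) // mxE -val_eqE ltn_eqF.
Qed.

Lemma invmx_conjK (t g : 'M[F]_n) : t \in unitmx ->
  invmx t *m (t *m g *m invmx t) *m invmx (invmx t) = g.
Proof. by move=> ut; rewrite invmxK !mulmxA mulmxKV // mulVmx // mul1mx. Qed.

Lemma UTgraph_conj (T : {set 'I_n * 'I_n}) (t g : 'M[F]_n) : indifference T ->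
  t \in UT F n -> (t *m g *m invmx t \in UTgraph F T) = (g \in UTgraph F T).
Proof.
move=> Tind tU; have gUT := mxgroup_UT F n.
apply/idP/idP=> h; last exact: UTgraph_conj_sub.
rewrite -(invmx_conjK g (mxgroup_unit gUT tU)); apply: UTgraph_conj_sub => //.
exact: mxgroup_inv.
Qed.

Lemma UTo_conj (T : {set 'I_n * 'I_n}) (t g : 'M[F]_n) : indifference T ->
  t \in UT F n -> (t *m g *m invmx t \in UTo F T) = (g \in UTo F T).
Proof.
move=> Tind tU; rewrite [LHS]inE [RHS]inE UTgraph_conj //; congr (_ && ~~ _).
apply: eq_existsb => E; apply: andb_id2l => Eind; apply: andb_id2l => _.
exact: UTgraph_conj.
Qed.

(** A graph with the most edges among the indifference graphs whose [UTgraph] contains [g] will do;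
    the empty graph is a candidate. *)
Lemma exists_UTo (g : 'M[F]_n) : g \in UT F n ->
  exists2 T : {set 'I_n * 'I_n}, indifference T & g \in UTo F T.
Proof.
move=> gU; pose P (T : {set 'I_n * 'I_n}) := indifference T && (g \in UTgraph F T).
have P0 : P set0.
  by rewrite /P indifference0; apply/UTgraphP; split=> // i j _; rewrite inE.
case: (arg_maxnP (fun T : {set 'I_n * 'I_n} => #|T|) P0) => T /andP[Tind gT] Tmax.
exists T => //; rewrite inE gT; apply/existsP=> -[E /and3P[Eind TE gE]].
have := Tmax E; rewrite /P Eind gE => /(_ isT) /=.
by rewrite leqNgt proper_card.
Qed.

(** Each superclass is stable under conjugation by UT, and the superclasses cover UT. *)
Lemma scfUT_conj (phi : {ffun 'M[F]_n -> C}) t g :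
  scfUT phi -> t \in UT F n -> phi (t *m g *m invmx t) = phi g.
Proof.
move=> [phi0 phiE] tU; have gUT := mxgroup_UT F n.
have [/exists_UTo[T Tind gT]|gU] := boolP (g \in UT F n).
  by apply: (phiE T Tind) => //; rewrite UTo_conj.
by rewrite !phi0 // mxgroup_conj.
Qed.

End Superclass.

(** * Shuffles *)

Section Shuffles.
Variables a b : nat.
Implicit Types w : 'S_(a + b).

Lemma shuffleP w :
  reflect ((forall i j : 'I_a, (i < j)%N -> (w (lshift b i) < w (lshift b j))%N) /\
           (forall i j : 'I_b, (i < j)%N -> (w (rshift a i) < w (rshift a j))%N))
          (shuffle w).
Proof.
apply: (iffP andP) => -[wl wr]; split.
- by move=> i j; move/forallP/(_ i)/forallP/(_ j)/implyP: wl.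
- by move=> i j; move/forallP/(_ i)/forallP/(_ j)/implyP: wr.
- by apply/forallP=> i; apply/forallP=> j; apply/implyP; apply: wl.
- by apply/forallP=> i; apply/forallP=> j; apply/implyP; apply: wr.
Qed.

Definition ord_lt n : rel 'I_n := fun i j => (i < j)%N.

Lemma ord_lt_trans n : transitive (@ord_lt n).
Proof. by move=> j i k; apply: ltn_trans. Qed.

Lemma sorted_enum n (I : {set 'I_n}) : sorted (@ord_lt n) (enum I).
Proof.
rewrite /enum_mem -enumT; apply: sorted_filter; first exact: ord_lt_trans.
have := iota_ltn_sorted 0 n; rewrite -val_enum_ord sorted_map.
by [].
Qed.

(** [w] lists [I] in increasing order, then its complement in increasing order. *)
Lemma exists_shuffle (I : {set 'I_(a + b)}) : #|I| = a ->
  exists2 w, shuffle w & forall j, w (rshift a j) \notin I.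
Proof.
move=> cardI; have cardIC : #|~: I| = b by rewrite cardsCs setCK card_ord cardI addKn.
pose s := enum I ++ enum (~: I).
have size_s : size s = (a + b)%N by rewrite size_cat -!cardE cardI cardIC.
have us : uniq s.
  rewrite cat_uniq !enum_uniq /= andbT; apply/hasPn=> i.
  by rewrite !mem_enum inE.
(* The default value [i] is never reached; [fl] and [fr] replace it by a common one, so that two
   entries can be compared. *)
pose f (i : 'I_(a + b)) := nth i s i.
have f_inj : injective f.
  move=> i j; rewrite /f (set_nth_default j) ?size_s // => /eqP.
  by rewrite nth_uniq ?size_s // => /eqP/val_inj.
have fl x0 (i : 'I_a) : f (lshift b i) = nth x0 (enum I) i.
  by rewrite /f nth_cat -cardE cardI /= ltn_ord; apply: set_nth_default; rewrite -cardE cardI.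
have fr x0 (j : 'I_b) : f (rshift a j) = nth x0 (enum (~: I)) j.
  rewrite /f nth_cat -cardE cardI ltnNge leq_addr /= addKn.
  by apply: set_nth_default; rewrite -cardE cardIC.
exists (perm f_inj).
  apply/shuffleP; split=> i j ij; rewrite !permE.
    rewrite (fl (lshift b i) i) (fl (lshift b i) j).
    by apply: (sorted_ltn_nth (@ord_lt_trans _)); rewrite ?sorted_enum ?inE -?cardE ?cardI.
  rewrite (fr (rshift a i) i) (fr (rshift a i) j).
  by apply: (sorted_ltn_nth (@ord_lt_trans _)); rewrite ?sorted_enum ?inE -?cardE ?cardIC.
move=> j; rewrite permE (fr (rshift a j)).
have : nth (rshift a j) (enum (~: I)) j \in enum (~: I) by rewrite mem_nth // -cardE cardIC.
by rewrite mem_enum inE.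
Qed.

(** The values of an increasing map form a sorted list, which is determined by the image. *)
Lemma mono_eq k n (f g : 'I_k -> 'I_n) :
  (forall i j : 'I_k, (i < j)%N -> (f i < f j)%N) ->
  (forall i j : 'I_k, (i < j)%N -> (g i < g j)%N) ->
  (forall i, exists j, g i = f j) -> (forall i, exists j, f i = g j) -> f =1 g.
Proof.
move=> f_lt g_lt gf fg.
suff /eq_in_map e : map f (enum 'I_k) = map g (enum 'I_k).
  by move=> i; apply: e; rewrite mem_enum.
have sorted_img (h : 'I_k -> 'I_n) : (forall i j : 'I_k, (i < j)%N -> (h i < h j)%N) ->
    sorted (@ord_lt n) (map h (enum 'I_k)).
  move=> h_lt; apply: (@homo_sorted _ _ _ (@ord_lt k) _ h_lt).
  by have := iota_ltn_sorted 0 k; rewrite -val_enum_ord sorted_map.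
apply: (irr_sorted_eq (@ord_lt_trans _)); rewrite ?sorted_img //.
  by move=> i; rewrite /ord_lt ltnn.
move=> i; apply/mapP/mapP=> -[j _ ->].
  by have [l ->] := fg j; exists l; rewrite ?mem_enum.
by have [l ->] := gf j; exists l; rewrite ?mem_enum.
Qed.

(** The hypothesis puts the image of the first a indices under [w] inside their image under [w'].
    Both have size a, so they agree, and this image determines a shuffle. *)
Lemma shuffle_eq w w' : shuffle w -> shuffle w' ->
  (forall i j, w' (rshift a i) != w (lshift b j)) -> w = w'.
Proof.
move=> /shuffleP[wl wr] /shuffleP[w'l w'r] ww'.
pose L (v : 'S_(a + b)) := [set v (lshift b i) | i : 'I_a].
have cardL v : #|L v| = a.
  by rewrite card_imset ?card_ord // => i j /perm_inj /lshift_inj.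
have memL (v : 'S_(a + b)) (k : 'I_(a + b)) : (v k \in L v) = (k < a)%N.
  apply/imsetP/idP=> [[i _ /perm_inj ->] //=|ka].
  by exists (Ordinal ka) => //; congr (v _); apply: val_inj.
have LL : L w = L w'.
  apply/eqP; rewrite eqEcard !cardL leqnn andbT; apply/subsetP=> _ /imsetP[j _ ->].
  rewrite -[w _](permKV w') memL; case: (split_ordP ((w'^-1)%g (w (lshift b j)))) => // i wi.
  by have := ww' i j; rewrite -wi permKV eqxx.
have el : (fun i => w (lshift b i)) =1 (fun i => w' (lshift b i)).
  apply: mono_eq => // i.
    have : w' (lshift b i) \in L w by rewrite LL memL /=.
    by case/imsetP=> j _ ->; exists j.
  have : w (lshift b i) \in L w' by rewrite -LL memL /=.
  by case/imsetP=> j _ ->; exists j.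
have er : (fun i => w (rshift a i)) =1 (fun i => w' (rshift a i)).
  have nl v v' : L v = L v' -> forall i, exists j, v (rshift a i) = v' (rshift a j).
    move=> e i; case: (split_ordP ((v'^-1)%g (v (rshift a i)))) => j vj; last first.
      by exists j; rewrite -vj permKV.
    have : v (rshift a i) \in L v by rewrite e -[v _](permKV v') memL vj /=.
    by rewrite memL /= ltnNge leq_addr.
  by apply: mono_eq => //; apply: nl.
apply/permP=> k; case: (split_ordP k) => i ->; [exact: el | exact: er].
Qed.

End Shuffles.

(** * The double cosets of UT and the parabolic *)

Section Bruhat.
Variables (F : finFieldType) (a b : nat).
Implicit Types (w : 'S_(a + b)) (x t : 'M[F]_(a + b)).

Lemma shuffle_mxE w (g : 'M[F]_a) u (h : 'M[F]_b) :
  shuffle_mx w g u h = perm_mx w^-1%g *m block_mx g u 0 h *m perm_mx w.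
Proof.
have -> : perm_mx w = perm_mx (w^-1)^-1 :> 'M[F]_(a + b) by rewrite invgK.
rewrite -col_permE -row_permE.
by apply/matrixP=> i j; rewrite !mxE.
Qed.

Lemma shuffle_mx_block w (m : 'M[F]_(a + b)) :
  perm_mx w^-1%g *m (perm_mx w *m m *m perm_mx w^-1%g) *m perm_mx w = m.
Proof.
rewrite !mulmxA -perm_mxM mulVg perm_mx1 mul1mx.
by rewrite -mulmxA -perm_mxM mulVg perm_mx1 mulmx1.
Qed.

Lemma shuffle_radicalP w (u : 'M[F]_(a, b)) : shuffle w ->
  reflect (forall i j, (w (rshift a j) < w (lshift b i))%N -> u i j = 0)
          (u \in shuffle_radical F w).
Proof.
move=> /shuffleP[wl wr]; rewrite inE.
have E i j : shuffle_mx w 1%:M u 1%:M (w i) (w j) = block_mx 1%:M u 0 1%:M i j.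
  by rewrite mxE !permK.
apply: (iffP (UTP _)) => [[_ m0] i j ji|u0].
  by have := m0 _ _ ji; rewrite E block_mxEur.
have wlK i j : (w (lshift b j) < w (lshift b i))%N -> i != j.
  by apply: contraTneq => ->; rewrite ltnn.
have wrK i j : (w (rshift a j) < w (rshift a i))%N -> i != j.
  by apply: contraTneq => ->; rewrite ltnn.
split=> [i|i j]; rewrite -(permKV w i); last rewrite -(permKV w j); rewrite E.
  by case: (split_ordP ((w^-1)%g i)) => k ->; rewrite ?block_mxEul ?block_mxEdr mxE eqxx.
case: (split_ordP ((w^-1)%g i)) => k ->; case: (split_ordP ((w^-1)%g j)) => l ->.
- by rewrite block_mxEul mxE => /wlK/negPf ->.
- by rewrite block_mxEur; apply: u0.
- by rewrite block_mxEdl mxE.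
- by rewrite block_mxEdr mxE => /wrK/negPf ->.
Qed.

(** Being increasing on both pieces, [w] preserves the order within each diagonal block; only
    entries of [u] can change sides of the diagonal, and the radical is the condition on these. *)
Lemma shuffle_mx_UT w (g : 'M[F]_a) u (h : 'M[F]_b) : shuffle w ->
  (shuffle_mx w g u h \in UT F (a + b)) =
  [&& g \in UT F a, h \in UT F b & u \in shuffle_radical F w].
Proof.
move=> sw; have /shuffleP[wl wr] := sw.
have E i j : shuffle_mx w g u h (w i) (w j) = block_mx g u 0 h i j.
  by rewrite mxE !permK.
apply/UTP/and3P=> [[m1 m0]|[/UTP[g1 g0] /UTP[h1 h0] /(shuffle_radicalP _ sw) u0]].
  split.
  - apply/UTP; split=> [i|i j ji]; first by rewrite -(m1 (w (lshift b i))) E block_mxEul.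
    by have := m0 _ _ (wl _ _ ji); rewrite E block_mxEul.
  - apply/UTP; split=> [i|i j ji]; first by rewrite -(m1 (w (rshift a i))) E block_mxEdr.
    by have := m0 _ _ (wr _ _ ji); rewrite E block_mxEdr.
  - by apply/(shuffle_radicalP _ sw) => i j /m0; rewrite E block_mxEur.
have mono k (f : 'I_k -> 'I_(a + b)) : (forall i j : 'I_k, (i < j)%N -> (f i < f j)%N) ->
    forall i j, (f j < f i)%N -> (j < i)%N.
  move=> f_lt i j; case: (ltngtP j i) => // [/f_lt ij ji|/val_inj ->]; last by rewrite ltnn.
  by have := ltn_trans ij ji; rewrite ltnn.
split=> [i|i j]; rewrite -(permKV w i); last rewrite -(permKV w j); rewrite E.
  by case: (split_ordP ((w^-1)%g i)) => k ->; rewrite ?block_mxEul ?block_mxEdr ?g1 ?h1.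
case: (split_ordP ((w^-1)%g i)) => k ->; case: (split_ordP ((w^-1)%g j)) => l ->.
- by rewrite block_mxEul => /(mono _ _ wl); apply: g0.
- by rewrite block_mxEur; apply: u0.
- by rewrite block_mxEdl mxE.
- by rewrite block_mxEdr => /(mono _ _ wr); apply: h0.
Qed.

(* Among all [t], minimize the number of nonzero rows of the first [a] columns
   of [t *m x]: a linear relation between these rows would allow to clear the
   first of them that it involves by means of the following ones. *)
Lemma exists_pivots x : x \in unitmx ->
  exists2 t, t \in UT F (a + b) &
    exists2 I : {set 'I_(a + b)}, #|I| = a &
      forall k j, k \notin I -> (t *m x) k (lshift b j) = 0.
Proof.
move=> ux; have gUT := mxgroup_UT F (a + b).
pose nz t := [set k | row k (lsubmx (t *m x)) != 0].
have U1 : 1%:M \in UT F (a + b) by case: gUT.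
case: (arg_minnP (fun t => #|nz t|) U1) => t tU tmin; exists t => //.
exists (nz t) => [|k j]; last first.
  by rewrite inE negbK => /eqP/rowP/(_ j); rewrite !mxE.
set A := lsubmx (t *m x).
(* The first a rows of the inverse of [t *m x] form a left inverse of [A]. *)
have rankA : \rank A = a.
  apply/eqP; rewrite eqn_leq rank_leq_col /=.
  have utx : t *m x \in unitmx by rewrite unitmx_mul ux (mxgroup_unit gUT).
  have /eqP rk1 : \rank (usubmx (invmx (t *m x)) *m A) == a; last first.
    by have := mxrankM_maxr (usubmx (invmx (t *m x))) A; rewrite rk1.
  apply/eqP; rewrite mulmx_lsub mul_usub_mx mulVmx // scalar_mx_block block_mxEv col_mxKu row_mxKl.
  exact: mxrank1.
pose B := rowsub (fun i : 'I_#|nz t| => enum_val i) A.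
have AB : (A <= B)%MS.
  apply/row_subP=> k; have [->|kA] := eqVneq (row k A) 0; first exact: sub0mx.
  have kI : k \in nz t by rewrite inE.
  by rewrite -(enum_rankK_in kI kI) -row_rowsub; apply: row_sub.
have aI : (a <= #|nz t|)%N.
  by have := leq_trans (mxrankS AB) (rank_leq_row B); rewrite rankA.
apply/eqP; rewrite eqn_leq aI andbT leqNgt; apply/negP=> Ia.
have [c /sub_kermxP cB c0] : exists2 c : 'rV_#|nz t|, (c <= kermx B)%MS & c != 0.
  apply/rowV0Pn; rewrite kermx_eq0 /row_free neq_ltn.
  by rewrite (leq_ltn_trans (rank_leq_col B)).
(* The relation [c] between the nonzero rows, extended by zero to all rows. *)
pose d : 'rV_(a + b) := c *m rowsub (fun i : 'I_#|nz t| => enum_val i) 1%:M.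
have dA : d *m A = 0 by rewrite /d -mulmxA mul_rowsub_mx mul1mx.
have dE i : d 0 (enum_val i) = c 0 i.
  rewrite mxE (bigD1 i) //= !mxE eqxx mulr1 big1 ?addr0 // => l li.
  by rewrite !mxE (inj_eq enum_val_inj) (negPf li) mulr0.
have [i ci] : exists i, c 0 i != 0.
  by apply/rV0Pn.
pose Q := [pred k : 'I_(a + b) | d 0 k != 0].
have Qi : Q (enum_val i) by rewrite /= dE.
case: (arg_minnP val Qi) => k0 /= dk0 k0min.
have k0I : k0 \in nz t.
  apply: contraNT dk0 => k0I; rewrite mxE big1 // => l _.
  rewrite !mxE; case: eqP => [e|]; last by rewrite mulr0.
  by rewrite -e enum_valP in k0I.
(* Row k0 is the relation divided by its first nonzero coefficient. It is 1 at k0 and 0 before, so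
   [e] is unitriangular, and [e *m t] has one nonzero row less. *)
pose e : 'M_(a + b) := \matrix_(i, j) if i == k0 then d 0 j / d 0 k0 else (i == j)%:R.
have eU : e \in UT F (a + b).
  apply/UTP; split=> [k|k l lk]; rewrite mxE; case: eqP => [ek|_].
  - by rewrite ek divff.
  - by rewrite eqxx.
  - rewrite (_ : d 0 l = 0) ?mul0r //; apply/eqP/negPn/negP=> /k0min.
    by rewrite leqNgt -ek lk.
  - by rewrite -val_eqE gtn_eqF.
have row_e k : row k (lsubmx (e *m t *m x)) = if k == k0 then 0 else row k A.
  rewrite -mulmxA -mulmx_lsub -/A row_mul; case: eqP => [->|/eqP kk0].
    have -> : row k0 e = (d 0 k0)^-1 *: d.
      by apply/rowP=> j; rewrite !mxE eqxx mulrC.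
    by rewrite -scalemxAl dA scaler0.
  have -> : row k e = row k 1%:M by apply/rowP=> j; rewrite !mxE (negPf kk0).
  by rewrite -row_mul mul1mx.
have etU : e *m t \in UT F (a + b) by rewrite mxgroup_mull.
have := tmin _ etU; rewrite leqNgt.
suff -> : nz (e *m t) = nz t :\ k0 by rewrite (cardsD1 k0 (nz t)) k0I ltnSn.
by apply/setP=> k; rewrite !inE row_e; case: (k == k0); rewrite ?eqxx.
Qed.

(** [perm_mx w] moves the rows outside [I], whose first a entries vanish, to the last b places. *)
Lemma exists_shuffle_parabolic x : x \in unitmx ->
  exists2 w, shuffle w &
    exists2 t, t \in UT F (a + b) & perm_mx w *m t *m x \in parabolic F a b.
Proof.
move=> ux; have [t tU [I cardI tI]] := exists_pivots ux.
have [w sw wI] := exists_shuffle cardI; exists w => //; exists t => //.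
rewrite inE !unitmx_mul unitmx_perm ux (mxgroup_unit (mxgroup_UT F _) tU) /=.
apply/eqP/matrixP=> i j; rewrite [RHS]mxE -[RHS](tI _ j (wI i)).
by rewrite -mulmxA -row_permE !mxE.
Qed.

(** An index shared by w'(last b) and w(first a) would put a diagonal entry of [t' *m invmx t],
    which is 1, into the lower left block of an element of the parabolic. *)
Lemma shuffle_parabolic_eq w w' t t' x : x \in unitmx -> shuffle w -> shuffle w' ->
  t \in UT F (a + b) -> t' \in UT F (a + b) ->
  perm_mx w *m t *m x \in parabolic F a b ->
  perm_mx w' *m t' *m x \in parabolic F a b -> w = w'.
Proof.
move=> ux sw sw' tU t'U wP w'P; have gUT := mxgroup_UT F (a + b).
have gP := mxgroup_parabolic F a b; have [_ PM _] := gP.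
have ut := mxgroup_unit gUT tU.
have up v : perm_mx v \in @unitmx F (a + b) := unitmx_perm _ v.
pose s := t' *m invmx t.
have sP : perm_mx w' *m s *m perm_mx w^-1%g \in parabolic F a b.
  have -> : perm_mx w^-1%g = invmx (perm_mx w) :> 'M[F]_(a + b).
    apply: (mulmx_inj (up w)).
    by rewrite mulmxV // -perm_mxM mulgV perm_mx1.
  have := PM _ _ w'P (mxgroup_inv gP wP).
  by rewrite !invmxM ?unitmx_mul ?up ?ut // !mulmxA mulmxK.
apply: shuffle_eq => // i j; apply/eqP=> e.
have /UTP[s1 _] : s \in UT F (a + b) by rewrite mxgroup_mulr // mxgroup_inv.
move: sP; rewrite inE => /andP[_ /eqP/matrixP/(_ i j)].
rewrite -col_permE -row_permE !mxE => s0.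
by have := s1 (w (lshift b j)); rewrite mxE -{1}e s0 => /esym/eqP; rewrite oner_eq0.
Qed.

End Bruhat.

(** * Coproducts *)

Section Coproduct.
Variables (F : finFieldType) (C : numClosedFieldType) (a b : nat).
Implicit Types w : 'S_(a + b).

Lemma invmx_perm w : invmx (perm_mx w) = perm_mx w^-1%g :> 'M[F]_(a + b).
Proof.
apply: (mulmx_inj (unitmx_perm _ w)).
by rewrite mulmxV ?unitmx_perm // -perm_mxM mulgV perm_mx1.
Qed.

(** This describes the intersection of P with w UT w^-1; moved back by [w], it is the subgroup UT_I
    x UT_J |x U_(I,J) of the coproduct. *)
Lemma perm_conj_UT_parabolic w s : shuffle w ->
  (s \in UT F (a + b)) && (perm_mx w *m s *m perm_mx w^-1%g \in parabolic F a b) =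
  (perm_mx w *m s *m perm_mx w^-1%g \in blocks (UT F a) (UT F b) (shuffle_radical F w)).
Proof.
move=> sw; apply/andP/blocksP => [[sU]|[y [v [z [e yU zU vR]]]]].
  rewrite parabolic_blocks => /blocksP[y [v [z [e _ _ _]]]].
  rewrite -(shuffle_mx_block w s) e -shuffle_mxE shuffle_mx_UT // in sU.
  by have /and3P[yU zU vR] := sU; exists y, v, z.
split; last by rewrite e parabolic_blocks mem_blocks !GLE !(mxgroup_unit (mxgroup_UT F _)) ?in_setT.
by rewrite -(shuffle_mx_block w s) e -shuffle_mxE shuffle_mx_UT // yU zU.
Qed.

(** The matrices counted form the coset through [t] of the intersection of UT with w^-1 P w. *)
Lemma card_UT_parabolic w t x : shuffle w -> t \in UT F (a + b) -> x \in unitmx ->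
  perm_mx w *m t *m x \in parabolic F a b ->
  #|[set s in UT F (a + b) | perm_mx w *m s *m x \in parabolic F a b]| =
  (#|UT F a| * #|UT F b| * #|shuffle_radical F w|)%N.
Proof.
move=> sw tU ux tP; rewrite -card_blocks.
have gUT := mxgroup_UT F (a + b); have ut := mxgroup_unit gUT tU.
have gP := mxgroup_parabolic F a b.
have f_inj : injective (fun m : 'M[F]_(a + b) => perm_mx w^-1%g *m m *m perm_mx w *m t).
  move=> m m' /(can_inj (mulmxK ut))/(can_inj (mulmxK (unitmx_perm _ w))).
  by move/(mulmx_inj (unitmx_perm _ _)).
rewrite -[RHS](card_imset _ f_inj); apply: eq_card => s.
pose r := s *m invmx t.
have rP : (perm_mx w *m s *m x \in parabolic F a b) =
    (perm_mx w *m r *m perm_mx w^-1%g \in parabolic F a b).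
  rewrite -[RHS](mxgroup_mulr _ gP tP) !mulmxA.
  by rewrite -(mulmxA _ (perm_mx w^-1%g)) -perm_mxM mulVg perm_mx1 mulmx1 mulmxKV.
have sU : (s \in UT F (a + b)) = (r \in UT F (a + b)).
  by rewrite mxgroup_mulr // mxgroup_inv.
rewrite in_set sU rP perm_conj_UT_parabolic //.
apply/idP/imsetP=> [rB|[m mB e]].
  by exists (perm_mx w *m r *m perm_mx w^-1%g); rewrite ?shuffle_mx_block ?mulmxKV.
suff -> : perm_mx w *m r *m perm_mx w^-1%g = m by [].
rewrite /r e mulmxK //.
by rewrite !mulmxA -perm_mxM mulgV perm_mx1 mul1mx -mulmxA -perm_mxM mulgV perm_mx1 mulmx1.
Qed.

Lemma sum_GL_bruhat (S : 'M[F]_(a + b) -> C) :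
  (forall t x, t \in UT F (a + b) -> x \in unitmx -> S (t *m x) = S x) ->
  \sum_(x in GL F (a + b)) S x =
  #|UT F (a + b)|%:R * (#|UT F a|%:R^-1 * #|UT F b|%:R^-1 *
    \sum_(w : 'S_(a + b) | shuffle w) #|shuffle_radical F w|%:R^-1 *
      \sum_(p in parabolic F a b) S (perm_mx w^-1%g *m p)).
Proof.
move=> S_UT; have gUT := mxgroup_UT F; have gP := mxgroup_parabolic F a b.
pose c w : C := (#|UT F a| * #|UT F b| * #|shuffle_radical F w|)%:R.
pose N w x := [set s in UT F (a + b) | perm_mx w *m s *m x \in parabolic F a b].
(* Exactly one shuffle has [N w x] nonempty, and then this set has [c w] elements. *)
have cN x : x \in unitmx -> \sum_(w | shuffle w) (c w)^-1 * #|N w x|%:R = 1.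
  move=> ux; have [w0 sw0 [t0 t0U t0P]] := exists_shuffle_parabolic ux.
  rewrite (bigD1 w0) //= big1 ?addr0 => [|w /andP[sw ww0]].
    rewrite (card_UT_parabolic sw0 t0U ux t0P) mulVf // pnatr_eq0 -lt0n !muln_gt0.
    rewrite !mxgroup_card_gt0 //=; apply/card_gt0P; exists 0.
    by apply/shuffle_radicalP=> // i j _; rewrite mxE.
  rewrite (_ : N w x = set0) ?cards0 ?mulr0 //; apply/setP=> t.
  rewrite [LHS]in_set in_set0.
  apply/negP=> /andP[tU tP]; case/eqP: ww0.
  exact: (shuffle_parabolic_eq ux sw sw0 tU t0U tP t0P).
transitivity (\sum_(x in GL F (a + b)) \sum_(w | shuffle w) (c w)^-1 *
    \sum_(t in UT F (a + b) | perm_mx w *m t *m x \in parabolic F a b) S x).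
  apply: eq_bigr => x; rewrite GLE => ux; rewrite -[LHS]mul1r -(cN x ux) mulr_suml.
  apply: eq_bigr => w _; rewrite -mulrA mulr_natl -sumr_const; congr (_ * _).
  by apply: eq_bigl => t; rewrite inE.
rewrite exchange_big /= [RHS]mulrA [RHS]mulr_sumr; apply: eq_bigr => w sw.
rewrite -mulr_sumr /c !natrM !invfM -!mulrA [RHS]mulrCA; congr (_ * _).
rewrite [RHS]mulrCA; congr (_ * _); rewrite [RHS]mulrCA; congr (_ * _).
rewrite (exchange_big_dep (mem (UT F (a + b)))) /= => [|x t _ /andP[]//].
rewrite mulr_natl -sumr_const; apply: eq_bigr => t tU.
have uwt : perm_mx w *m t \in unitmx by rewrite unitmx_mul unitmx_perm (mxgroup_unit (gUT _) tU).
(* Substituting p = w t x gives w^-1 p = t x, and [S] is invariant under [t]. *)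
rewrite -[RHS](sum_mulmxl _ _ uwt); apply: eq_big => x.
  rewrite GLE tU; apply: andb_idl => /(mxgroup_unit gP).
  by rewrite unitmx_mul => /andP[].
rewrite GLE => /andP[ux _].
by rewrite !mulmxA -perm_mxM mulVg perm_mx1 mul1mx S_UT.
Qed.

Lemma comulUT0 (phi : {ffun 'M[F]_(a + b) -> C}) g h : scfUT phi ->
  ~~ ((g \in UT F a) && (h \in UT F b)) -> comulUT phi (g, h) = 0.
Proof.
move=> [phi0 _] gh; rewrite ffunE big1 // => w sw; rewrite big1 ?mulr0 // => u _.
rewrite phi0 // shuffle_mx_UT //; apply: contra gh => /and3P[gU hU _].
by rewrite gU.
Qed.

(** By [conj_ublock] the upper right block runs over all matrices as [u] does, whatever [v] is;
    since [phi] vanishes outside UT, only the radical contributes. *)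
Lemma sum_conj_ublock (phi : {ffun 'M[F]_(a + b) -> C}) w y v z g h :
  scfUT phi -> shuffle w -> y \in unitmx -> z \in unitmx ->
  \sum_u phi (perm_mx w^-1%g *m block_mx y v 0 z *m block_mx g u 0 h *m
              invmx (perm_mx w^-1%g *m block_mx y v 0 z)) =
  \sum_(u in shuffle_radical F w)
     phi (shuffle_mx w (y *m g *m invmx y) u (z *m h *m invmx z)).
Proof.
move=> [phi0 _] sw uy uz.
have up : block_mx y v 0 z \in unitmx by rewrite unitmxE det_ublock unitrM -!unitmxE uy.
pose c := v *m h *m invmx z - y *m g *m invmx y *m v *m invmx z.
pose f u := phi (shuffle_mx w (y *m g *m invmx y) u (z *m h *m invmx z)).
transitivity (\sum_u f (y *m u *m invmx z + c)).
  apply: eq_bigr => u _; rewrite conj_mulmx ?unitmx_perm // conj_ublock //.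
  by rewrite -invmx_perm invmxK /f shuffle_mxE invmx_perm.
transitivity (\sum_u f u).
  rewrite [RHS](reindex (fun u => y *m u *m invmx z + c)) //.
  exists (fun u => invmx y *m (u - c) *m z) => u _.
    by rewrite addrK !mulmxA mulVmx // mul1mx mulmxKV.
  by rewrite !mulmxA mulmxV // mul1mx mulmxK // subrK.
rewrite (bigID (mem (shuffle_radical F w))) /= [X in _ + X]big1 ?addr0 // => u uR.
by rewrite /f phi0 // shuffle_mx_UT // (negPf uR) !andbF.
Qed.

Lemma comulGL_IndUT (phi : {ffun 'M[F]_(a + b) -> C}) : scfUT phi ->
  comulGL (IndUT phi) = tensor_map (@IndUT F C a) (@IndUT F C b) (comulUT phi).
Proof.
move=> scf_phi; apply/ffunP=> -[g h]; rewrite ffunE [RHS]ffunE /=.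
pose T w y z := \sum_(u in shuffle_radical F w)
  phi (shuffle_mx w (y *m g *m invmx y) u (z *m h *m invmx z)).
pose r w : C := #|shuffle_radical F w|%:R^-1.
(* The sum over [w] is moved outside, to match the shape that [sum_GL_bruhat] gives to the left
   side. *)
have -> : IndUT [ffun h' => IndUT [ffun g' => comulUT phi (g', h')] g] h =
    #|UT F a|%:R^-1 * #|UT F b|%:R^-1 * \sum_(w : 'S_(a + b) | shuffle w) r w *
      \sum_(y in GL F a) \sum_(z in GL F b) T w y z.
  have IE h' : IndUT [ffun g' => comulUT phi (g', h')] g =
      #|UT F a|%:R^-1 * \sum_(y in GL F a) comulUT phi (y *m g *m invmx y, h').
    rewrite /IndUT induceE; first by congr (_ * _); apply: eq_bigr => y _; rewrite ffunE.
    by move=> g' g'U; rewrite ffunE comulUT0 // (negPf g'U).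
  rewrite [LHS]induceE => [|h' h'U]; last first.
    rewrite ffunE IE big1 ?mulr0 // => y _.
    by rewrite comulUT0 // (negPf h'U) andbF.
  under eq_bigr => z _ do rewrite ffunE IE.
  rewrite -mulr_sumr mulrA [X in X * _]mulrC; congr (_ * _).
  rewrite exchange_big /=.
  under eq_bigr => y _ do under eq_bigr => z _ do rewrite ffunE /=.
  under eq_bigr => y _ do rewrite exchange_big /=.
  rewrite exchange_big /=; apply: eq_bigr => w sw.
  by rewrite mulr_sumr; apply: eq_bigr => y _; rewrite mulr_sumr.
have q0 : (#|F| ^ (a * b))%:R != 0 :> C.
  by rewrite pnatr_eq0 -lt0n expn_gt0; apply/orP; left; apply/card_gt0P; exists 0.
apply: (mulfI q0); rewrite mulVKf //.
have UT0 := card_mxgroup_neq0 C (mxgroup_UT F (a + b)).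
have gUT := mxgroup_UT F (a + b).
have IndE (u : 'M_(a, b)) : IndUT phi (block_mx g u 0 h) =
    #|UT F a|%:R^-1 * #|UT F b|%:R^-1 * \sum_(w : 'S_(a + b) | shuffle w) r w *
      \sum_(p in parabolic F a b) phi (perm_mx w^-1%g *m p *m block_mx g u 0 h *m
                                      invmx (perm_mx w^-1%g *m p)).
  rewrite IndUTE // (sum_GL_bruhat (S := fun x => phi (x *m _ *m invmx x))) ?mulKf //.
  move=> t x tU ux; rewrite conj_mulmx ?(mxgroup_unit gUT tU) //.
  exact: scfUT_conj scf_phi tU.
rewrite (eq_bigr _ (fun u _ => IndE u)).
rewrite -mulr_sumr mulrCA; congr (_ * _).
rewrite exchange_big /= mulr_sumr; apply: eq_bigr => w sw.
rewrite -mulr_sumr mulrCA; congr (_ * _).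
rewrite exchange_big /= parabolic_blocks big_blocks mulr_sumr; apply: eq_bigr => y yG.
rewrite mulr_sumr; apply: eq_bigr => z zG.
(* The summand does not depend on [v], so the sum over [v] yields q^(ab), which is the normalization
   in [comulGL]. *)
rewrite (eq_bigr (fun _ => T w y z)) => [|v _]; last first.
  by rewrite sum_conj_ublock -?GLE.
by rewrite sumr_const cardsT card_mx mulr_natl.
Qed.

End Coproduct.

(** * The morphism of combinatorial Hopf algebras *)

Section HopfData.
Variables (F : finFieldType) (C : numClosedFieldType).

Lemma inner_lincomb n (G : {set 'M[F]_n}) k (phi psi chi : {ffun 'M[F]_n -> C}) :
  inner G (lincomb k phi psi) chi = k * inner G phi chi + inner G psi chi.
Proof.
rewrite /inner mulrCA -mulrDr; congr (_ * _).
by rewrite mulr_sumr -big_split; apply: eq_bigr => g _; rewrite /= ffunE mulrDl mulrA.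
Qed.

Lemma induce_lincomb n (H G : {set 'M[F]_n}) k (phi psi : {ffun 'M[F]_n -> C}) :
  induce H G (lincomb k phi psi) = lincomb k (induce H G phi) (induce H G psi).
Proof.
apply/ffunP=> g; rewrite !ffunE mulrCA -mulrDr; congr (_ * _).
by rewrite mulr_sumr -big_split; apply: eq_bigr => x _; rewrite /= ffunE.
Qed.

Lemma mem_UT0 (g : 'M[F]_0) : g \in UT F 0.
Proof. by apply/UTP; split=> -[]. Qed.

Lemma scfUT_one0 : scfUT (one0 F C).
Proof. by split=> [g|E _ g h _ _]; rewrite ?mem_UT0 // !ffunE. Qed.

Lemma IndUT0 (phi : {ffun 'M[F]_0 -> C}) : IndUT phi = phi.
Proof.
have GU : GL F 0 = UT F 0.
  by apply/setP=> x; rewrite mem_UT0 GLE (mxgroup_unit (mxgroup_UT F 0)) ?mem_UT0.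
apply/ffunP=> g; rewrite /IndUT induceE => [|h]; last by rewrite mem_UT0.
rewrite GU (eq_bigr (fun _ => phi g)) => [|x _]; last by rewrite (flatmx0 (_ *m _)) (flatmx0 g).
by rewrite sumr_const -[phi g *+ _]mulr_natl mulKf // card_mxgroup_neq0 //; apply: mxgroup_UT.
Qed.

Lemma linear_character_zeta : linear_character (hopfUT F C) (@zeta F C).
Proof.
split=> [n k phi psi _ _||a b phi psi]; last exact: zeta_mulUT.
  by rewrite /zeta inner_lincomb mulrDr mulrDl mulrCA !mulrA.
by rewrite zetaE ?ffunE ?mulr1 // => g _; rewrite !ffunE.
Qed.

Lemma linear_character_epsilon : linear_character (hopfGL F C) (@epsilon F C).
Proof.
split=> [n k phi psi _ _||a b phi psi]; last exact: epsilon_mulGL.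
  by rewrite /epsilon inner_lincomb mulrDl mulrA.
(* The unit is its own induced function, so its value is inherited from [zeta]. *)
rewrite -[hone _]IndUT0 -zeta_epsilon_Ind; last exact: scfUT_one0.
by have [_ ->] := linear_character_zeta.
Qed.

Lemma graded_hopf_morphism_IndUT :
  graded_hopf_morphism (hopfUT F C) (hopfGL F C) (@IndUT F C).
Proof.
split=> [||a b phi psi|phi _|a b phi].
- split=> [n phi _|n k phi psi _ _]; first exact: cfGL_IndUT.
  exact: induce_lincomb.
- exact: IndUT0.
- exact: IndUT_mulUT.
- by rewrite IndUT0.
- exact: comulGL_IndUT.
Qed.

End HopfData.

Theorem theorem3p3 (F : finFieldType) (R : realType) :
  [/\ linear_character (hopfUT F R[i]%C) (@zeta F R[i]%C),
      forall (n : nat) (phi : {ffun 'M[F]_n -> R[i]%C}),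
        scfUT phi -> zeta phi = epsilon (IndUT phi)
    & CHA_morphism (hopfUT F R[i]%C) (@zeta F R[i]%C)
                   (hopfGL F R[i]%C) (@epsilon F R[i]%C)
                   (@IndUT F R[i]%C)].
Proof.
split; first exact: linear_character_zeta.
  by move=> n phi; apply: zeta_epsilon_Ind.
split; first exact: linear_character_zeta.
- exact: linear_character_epsilon.
- exact: graded_hopf_morphism_IndUT.
- by move=> n phi; apply: zeta_epsilon_Ind.
Qed.
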